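(* Let $Z\subset S^1$ with $|Z|\ge4$ be such that no point of $Z$ is a limit point of $Z$ and each limit point of $Z$ is a limit of points of $Z$ from both sides. Let $T$ be a triangulation of $Z$, $\mathscr{T}=\mathscr{T}(T)$ the corresponding cluster tilting subcategory of $\mathscr{C}(Z)$, and let $e\neq f$ be in $Z$. Let $e=e_0,e_1,\dots,e_{2i+1}=f$ be the vertices of the zig-zag path from $e$ to $f$ with respect to $T$. Then $$\mathrm{ind}_{\mathscr{T}}\{e,f\}=\sum_{m=0}^{2i}(-1)^m\big[\{e_m,e_{m+1}\}\big]\in K_0^{\mathrm{split}}(\mathscr{T}),$$ where $\{a,b\}$ denotes the zero object if $\{a,b\}$ is an edge.
   Context: **Combinatorics.** $S^1$ is oriented counterclockwise, and inequalities refer to the counterclockwise cyclic order. For $z\in Z$, $z^\pm$ are its immediate counterclockwise successor ($+$) and predecessor ($-$) in $Z$. For $x,y\in S^1$, $\llbracket x,y\rrbracket$ is the set traced from $x$ to $y$ counterclockwise; ''first'' and ''last'' refer to this direction. An arc of $Z$ is a set $\{z_1,z_2\}$ with $z_1\ne z_2$ in $Z$; it is an edge if the $z_i$ are neighbours in $Z$, otherwise a diagonal. Diagonals $\{a,b\},\{c,d\}$ cross if $a<c<b<d<a$ or $a<d<b<c<a$. A limit point $y$ of $Z$ is surrounded by a fountain of $T$ if for some $z\in Z$, $T$ contains diagonals $\{z_n,z\},\{z_n',z\}$ ($n\in\mathbb N$) with $z_n\to y$ and $z'_n\to y$ from the two different sides; it is surrounded by a leapfrog of $T$ if $T$ contains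 diagonals $\{z_n,z_{n+1}\}$ ($n\in\mathbb N$) with $z_{2n}$ and $z_{2n+1}$ converging to $y$ from the two different sides. A triangulation of $Z$ is a maximal set $T$ of pairwise noncrossing diagonals such that each limit point of $Z$ is surrounded by a fountain or a leapfrog of $T$. **Zig-zag path.** Given $e\ne f$ in $Z$: $e_0=e$; $e_1$ is the last vertex in $\llbracket e_0^+,f\rrbracket$ connected to $e_0$ by an edge of $Z$ or a diagonal in $T$; for $j\ge1$, as long as $e_{2j-1}\neq f$, $e_{2j}$ is the first vertex in $\llbracket f^+,e_{2j-2}^-\rrbracket$ connected to $e_{2j-1}$ by a diagonal in $T$, and $e_{2j+1}$ is the last vertex in $\llbracket e_{2j-1}^+,f\rrbracket$ connected to $e_{2j}$ by an edge of $Z$ or a diagonal in $T$. All these vertices exist, and the construction terminates with some $e_{2i+1}=f$, $i\ge0$. Each $\{e_m,e_{m+1}\}$ is an edge or a diagonal in $T$. **The category $\mathscr{C}(Z)$** (Igusa--Todorov). Let $k$ be an algebraically closed field, $R=k[[t]]$, and let $RZ$ be the $R$-linear category with object set $Z$, $\mathrm{Hom}(z_1,z_2)=Rf_{z_2z_1}$ free of rank one, $f_{z_3z_2}f_{z_2z_1}=t^cf_{z_3z_1}$ with $c=1$ if $z_1\le z_3<z_2$ (counterclockwise from $z_1$) and $c=0$ otherwise. The map $z\mapsto z^+$ induces an autoequivalence $\phi$ of $\mathrm{add}\,RZ$, with natural transformation $\eta:\mathrm{id}\to\phi$ given by $f_{z^+z}$. $\mathscr{MF}(Z)$ is the category of pairs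 $(P,d)$, $P\in\mathrm{add}\,RZ$, $d:P\to P$ with $d^2=t\cdot\mathrm{id}$ and $d$ factoring through $\eta_P$; with exact structure given by sequences whose underlying sequence in $\mathrm{add}\,RZ$ is split exact it is a Frobenius category, and $\mathscr{C}(Z)$ is its stable category. It is $k$-linear, Hom-finite, Krull--Schmidt, triangulated and 2-Calabi--Yau. Its indecomposable objects are indexed by (and identified with) the diagonals $\{z_1,z_2\}$ of $Z$; $\Sigma\{z_1,z_2\}=\{z_1^-,z_2^-\}$; $\dim_k\mathrm{Ext}^1(x,y)$ is $1$ if the diagonals $x,y$ cross and $0$ otherwise. Its cluster tilting subcategories are exactly the $\mathscr{T}(T)=\mathrm{add}\,T$ for $T$ a triangulation of $Z$. **Index.** $K_0^{\mathrm{split}}(\mathscr{T})$ is the split Grothendieck group of $\mathscr{T}$, free on the classes of the diagonals in $T$. For $s\in\mathscr{C}(Z)$, $\mathrm{ind}_{\mathscr{T}}(s)=[t_0]-[t_1]$ for a distinguished triangle $t_1\to t_0\to s\to\Sigma t_1$ with $t_0,t_1\in\mathscr{T}$. *)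

(* Defs.v *)
From HB Require Import structures.
From mathcomp Require Import all_boot all_order all_algebra.
From mathcomp Require Import all_classical all_reals all_analysis.
From mathcomp.multinomials Require Import freeg.

Set Implicit Arguments.
Unset Strict Implicit.
Unset Printing Implicit Defensive.

Import Order.TTheory GRing.Theory Num.Theory.
Import numFieldNormedType.Exports.

Local Open Scope classical_set_scope.
Local Open Scope ring_scope.

Definition circle (R : realType) :=
  {p : R * R | p.1 ^+ 2 + p.2 ^+ 2 == 1}.

Section Circle.
Variable R : realType.

Lemma circle_pt_subproof (a : R) :
  (cos a, sin a).1 ^+ 2 + (cos a, sin a).2 ^+ 2 == 1.
Proof. by rewrite /= cos2Dsin2. Qed.

Definition circle_pt (a : R) : circle R := exist _ (cos a, sin a) (circle_pt_subproof a).

(* The set traced when moving counterclockwise from x to y; it is [set x] when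
   x = y. *)
Definition ccw_arc (x y : circle R) : set (circle R) :=
  [set p | exists a th b, [/\ x = circle_pt a, p = circle_pt th,
     y = circle_pt b & [/\ a <= th, th <= b & b < a + pi *+ 2]]].

(* x < p < y in the counterclockwise cyclic order. *)
Definition ccw (x p y : circle R) : Prop :=
  [/\ ccw_arc x y p, p <> x & p <> y].

(* Limit points are taken in the plane, in which the circle is closed. *)
Definition is_limit (Z : set (circle R)) (y : circle R) : Prop :=
  limit_point [set sval z | z in Z] (sval y).

(* u converges to y from the counterclockwise side of y if s = true, and from
   the clockwise side if s = false. *)
Definition tends_from (s : bool) (u : nat -> circle R) (y : circle R) : Prop :=
  exists (a : R) (th : nat -> R),
    [/\ y = circle_pt a, (forall n, 0 < th n), th n @[n --> \oo] --> 0
      & forall n, u n = circle_pt (if s then a + th n else a - th n)].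

Definition two_sided_limit (Z : set (circle R)) (y : circle R) : Prop :=
  forall s, exists2 u : nat -> circle R,
    (forall n, Z (u n)) & tends_from s u y.

Lemma circle_ptP (p : circle R) : exists a, p = circle_pt a.
Proof.
case: p => -[x y] /= h.
have h1 : x ^+ 2 + y ^+ 2 = 1 by apply/eqP.
have hx : -1 <= x <= 1.
  rewrite -ler_norml -(@ler_pXn2r _ 2) ?nnegrE // expr1n.
  by rewrite real_normK ?num_real // -h1 lerDl sqr_ge0.
have hy : Num.sqrt (1 - x ^+ 2) = `|y| by rewrite -h1 addrAC subrr add0r sqrtr_sqr.
case: (leP 0 y) => y0.
  exists (acos x); apply/val_inj => /=.
  by rewrite acosK ?in_itv //= sin_acos // hy ger0_norm.
exists (- acos x); apply/val_inj => /=.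
by rewrite cosN sinN acosK ?in_itv //= sin_acos // hy ltr0_norm // opprK.
Qed.

Lemma cos_eq1_lt2pi (a : R) : 0 <= a < pi *+ 2 -> cos a = 1 -> a = 0.
Proof.
move=> /andP[a0 a2] ca.
have pi0 := pi_ge0 R.
case: (leP a pi) => [ap|pa].
  by apply: cos_inj; rewrite ?in_itv /= ?a0 ?ap ?lexx ?pi0 // ca cos0.
have e : cos (pi *+ 2 - a) = cos 0.
  by rewrite addrC cosD2pi cosN ca cos0.
have ea : pi *+ 2 - a = 0.
  apply: (@cos_inj R) e; rewrite in_itv /=; last by rewrite lexx pi0.
  by rewrite subr_ge0 (ltW a2) mulr2n lerBlDr lerD2l (ltW pa).
by move/eqP: ea; rewrite subr_eq0 => /eqP ea; rewrite ea ltxx in a2.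
Qed.

Lemma circle_pt_inj_lt2pi (a b : R) :
  a <= b < a + pi *+ 2 -> circle_pt a = circle_pt b -> a = b.
Proof.
move=> /andP[ab ba] [ec es].
have : cos (b - a) = 1 by rewrite cosB -ec -es -!expr2 cos2Dsin2.
move=> /cos_eq1_lt2pi H; apply/esym/eqP; rewrite -subr_eq0; apply/eqP/H.
by rewrite subr_ge0 ab ltrBlDl.
Qed.

Lemma ccw_arcxx (x p : circle R) : ccw_arc x x p -> p = x.
Proof.
move=> [a [th [b [-> -> eb [h1 h2 h3]]]]].
have eab : a = b.
  by apply: circle_pt_inj_lt2pi; rewrite // (le_trans h1 h2).
suff -> : th = a by [].
by apply/le_anti; rewrite h1 eab h2.
Qed.

Lemma circle_pt_periodic (a : R) : circle_pt (a + pi *+ 2) = circle_pt a.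
Proof. by apply/val_inj; rewrite /= cosD2pi sinD2pi. Qed.

Lemma circle_pt_window (x : R) (p : circle R) :
  exists2 b, p = circle_pt b & x <= b < x + pi *+ 2.
Proof.
have [c ->] := circle_ptP p.
have P0 : (0 : R) < pi *+ 2 by rewrite mulrn_wgt0 // pi_gt0.
pose q := (c - x) / (pi *+ 2).
have hq := floor_itv q.
have hp (n : nat) a : circle_pt (a + (pi *+ 2) *+ n) = circle_pt a.
  by elim: n => [|n IH]; rewrite ?addr0 // mulrS addrCA addrC circle_pt_periodic.
have hz (m : int) a : circle_pt (a + (pi *+ 2) *~ m) = circle_pt a.
  case: m => n; first exact: hp.
  by rewrite -(hp n.+1 (a + _)) NegzE mulrNz -addrA addNr addr0.
exists (c - (pi *+ 2) *~ Num.floor q); first by rewrite -mulrNz hz.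
set P := pi *+ 2 in P0 q hq *; set m := Num.floor q in hq *.
have ec : c = x + q * P by rewrite /q divfK ?gt_eqF // addrC subrK.
have -> : c - P *~ m = x + (q - m%:~R) * P.
  by rewrite ec mulrBl -[P *~ m]mulrzl addrA.
move: hq => /andP[h1 h2]; apply/andP; split.
  by rewrite lerDl mulr_ge0 ?subr_ge0 // ltW.
rewrite ltrD2l -[X in _ < X]mul1r ltr_pM2r // ltrBlDr addrC.
by move: h2; rewrite intrD.
Qed.

Lemma ccw_arc_ends (x y : circle R) : ccw_arc x y x /\ ccw_arc x y y.
Proof.
have [a ->] := circle_ptP x.
have [b -> /andP[h1 h2]] := circle_pt_window a y.
by split; [exists a, a, b | exists a, b, b].
Qed.

End Circle.

Section Combinatorics.
Variables (R : realType) (Z : set (circle R)).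

Local Notation arc x y := (ccw_arc (sval x) (sval y)).

(* The default values are irrelevant under the standing assumptions on Z. *)
Definition succZ (z : Z) : Z :=
  xget z [set w : Z | w <> z /\
    forall v : Z, arc z w (sval v) -> v = z \/ v = w].

Definition predZ (z : Z) : Z :=
  xget z [set w : Z | w <> z /\
    forall v : Z, arc w z (sval v) -> v = w \/ v = z].

Definition is_edge (a b : Z) : Prop := a <> b /\ (b = succZ a \/ a = succZ b).

Definition is_diagonal (a b : Z) : Prop := a <> b /\ ~ is_edge a b.

Definition cross4 (a c b d : Z) : Prop :=
  ccw (sval a) (sval c) (sval b) /\ ccw (sval b) (sval d) (sval a).

Definition crossing (a b c d : Z) : Prop := cross4 a c b d \/ cross4 a d b c.

Definition noncrossing_diagonals (T : set (set Z)) : Prop :=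
  (forall A, T A -> exists a b, A = [set a; b] /\ is_diagonal a b) /\
  (forall a b c d, T [set a; b] -> T [set c; d] -> ~ crossing a b c d).

Definition has_fountain (T : set (set Z)) (y : circle R) : Prop :=
  exists (z : Z) (u u' : nat -> Z),
    [/\ tends_from true (sval \o u) y, tends_from false (sval \o u') y
      & forall n, T [set u n; z] /\ T [set u' n; z]].

Definition has_leapfrog (T : set (set Z)) (y : circle R) : Prop :=
  exists (s : bool) (u : nat -> Z),
    [/\ tends_from s (fun n => sval (u n.*2)) y,
        tends_from (~~ s) (fun n => sval (u n.*2.+1)) y
      & forall n, T [set u n; u n.+1]].

Definition triangulation (T : set (set Z)) : Prop :=
  [/\ noncrossing_diagonals T,
      (forall T', noncrossing_diagonals T' -> T `<=` T' -> T' = T)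
    & forall y, is_limit Z y -> has_fountain T y \/ has_leapfrog T y].

Definition first_in (x y : Z) (P : Z -> Prop) (v : Z) : Prop :=
  [/\ arc x y (sval v), P v
    & forall w, arc x y (sval w) -> P w -> arc x w (sval v)].

Definition last_in (x y : Z) (P : Z -> Prop) (v : Z) : Prop :=
  [/\ arc x y (sval v), P v
    & forall w, arc x y (sval w) -> P w -> arc x v (sval w)].

Definition linked (T : set (set Z)) (a b : Z) : Prop :=
  is_edge a b \/ T [set a; b].

(* p 0, ..., p (2i+1) are the vertices of the zig-zag path from e to f;
   the other values of p are irrelevant. *)
Definition zigzag (T : set (set Z)) (e f : Z) (i : nat) (p : nat -> Z) : Prop :=
  [/\ p 0%N = e,
      last_in (succZ (p 0%N)) f (linked T (p 0%N)) (p 1%N),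
      (forall j, (0 < j <= i)%N ->
        [/\ p j.*2.-1 <> f,
            first_in (succZ f) (predZ (p j.*2.-2))
              (fun v => T [set p j.*2.-1; v]) (p j.*2)
          & last_in (succZ (p j.*2.-1)) f (linked T (p j.*2)) (p j.*2.+1)])
    & p i.*2.+1 = f].

(* The exponent c with f_{z3 z2} f_{z2 z1} = t^c f_{z3 z1}. *)
Definition wind (z1 z2 z3 : Z) : nat :=
  `[< arc z1 z2 (sval z3) /\ z3 <> z2 >].

Lemma wind_xx (z w : Z) : wind z z w = 0%N.
Proof.
rewrite /wind asboolF // => -[/ccw_arcxx/val_inj h]; exact.
Qed.

Lemma wind_xyx (x y : Z) : x <> y -> wind x y x = 1%N.
Proof.
by move=> xy; rewrite /wind asboolT //; split=> //; case: (ccw_arc_ends (sval x) (sval y)).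
Qed.

Lemma wind_succ (x y : Z) : x <> y -> wind x (succZ x) y = 0%N.
Proof.
move=> xy; rewrite /succZ; case: xgetP => [w _ [_ H]|_]; last exact: wind_xx.
by rewrite /wind asboolF // => -[/H[] // /esym].
Qed.

End Combinatorics.

Definition fps (k : comNzRingType) : Type := nat -> k.

Section PowerSeries.
Variable k : comNzRingType.

HB.instance Definition _ := GRing.Zmodule.copy (fps k) (nat -> k).

Definition fps_one : fps k := fun n => (n == 0%N)%:R.

Definition fps_mul (f g : fps k) : fps k :=
  fun n => \sum_(i < n.+1) f i * g (n - i)%N.

Definition fps_trunc (n : nat) (f : fps k) : {poly k} := \poly_(i < n.+1) f i.

Lemma fps_mulE (f g : fps k) n m : (n <= m)%N ->
  fps_mul f g n = (fps_trunc m f * fps_trunc m g)`_n.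
Proof.
move=> nm; rewrite coefM; apply: eq_bigr => i _.
by rewrite !coef_poly !ltnS (leq_trans (leq_ord i)) // (leq_trans (leq_subr _ _)).
Qed.

Lemma fps_mulA : associative fps_mul.
Proof.
move=> f g h; apply/funext => n.
rewrite {1}/fps_mul [RHS]/fps_mul.
transitivity ((fps_trunc n f * (fps_trunc n g * fps_trunc n h))`_n).
  rewrite coefM; apply: eq_bigr => i _.
  by rewrite (@fps_mulE g h _ n) ?leq_subr // coef_poly ltnS leq_ord.
rewrite mulrA coefM; apply: eq_bigr => i _.
by rewrite (@fps_mulE f g _ n) ?leq_ord // coef_poly ltnS leq_subr.
Qed.

Lemma fps_mulC : commutative fps_mul.
Proof.
by move=> f g; apply/funext => n; rewrite !(@fps_mulE _ _ n n) // mulrC.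
Qed.

Lemma fps_mul1 : left_id fps_one fps_mul.
Proof.
move=> f; apply/funext => n.
rewrite /fps_mul big_ord_recl /= /fps_one eqxx mul1r subn0 big1 ?addr0 // => i _.
by rewrite mul0r.
Qed.

Lemma fps_mulDl : left_distributive fps_mul +%R.
Proof.
move=> f g h; apply/funext => n.
rewrite -[RHS]/(fps_mul f h n + fps_mul g h n) /fps_mul -big_split.
by apply: eq_bigr => i _; exact: mulrDl.
Qed.

Lemma fps_oner_neq0 : fps_one != 0.
Proof.
apply/eqP => /(congr1 (fun f : fps k => f 0%N)) /eqP.
by rewrite /fps_one eqxx oner_eq0.
Qed.

HB.instance Definition _ := GRing.Zmodule_isComNzRing.Build (fps k)
  fps_mulA fps_mulC fps_mul1 fps_mulDl fps_oner_neq0.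

Definition fps_t : fps k := fun n => (n == 1%N)%:R.

End PowerSeries.

Record addRZ (R : realType) (Z : set (circle R)) :=
  AddRZ { rk : nat; vtx : 'I_rk -> Z }.

(* Objects of add RZ are finite direct sums of objects of RZ. The entries of the
   matrix of a morphism are its coefficients on the basis elements f_{z' z}, with
   columns indexed by the summands z of the source. *)
Definition hom (R : realType) (Z : set (circle R)) (k : comNzRingType)
  (P Q : addRZ Z) := 'M[fps k]_(rk Q, rk P).
Arguments hom {R Z} k P Q.

Section AddRZ.
Variables (R : realType) (Z : set (circle R)) (k : comNzRingType).
Implicit Types P Q S : addRZ Z.

Definition idm P : hom k P P := 1%:M.

Definition hcomp P Q S (g : hom k Q S) (f : hom k P Q) : hom k P S :=
  \matrix_(i, j) \sum_l
    fps_t k ^+ wind (vtx j) (vtx l) (vtx i) * g i l * f l j.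

Definition phi P : addRZ Z := AddRZ (fun i : 'I_(rk P) => succZ (vtx i)).

(* The coefficients of the f_{z^+ z} are 1. *)
Definition eta_mor P : hom k P (phi P) := (1%:M : 'M[fps k]_(rk P)).

Definition add_zero : addRZ Z := @AddRZ R Z 0 (fun i => False_rect Z (notF (ltn_ord i))).

Definition add_sum P Q : addRZ Z :=
  @AddRZ R Z (rk P + rk Q) (fun i =>
    match fintype.split i with inl j => vtx j | inr j => vtx j end).

Lemma split_lshift m n (i : 'I_m) : fintype.split (lshift n i) = inl i.
Proof. exact: (unsplitK (inl i)). Qed.

Lemma split_rshift m n (i : 'I_n) : fintype.split (rshift m i) = inr i.
Proof. exact: (unsplitK (inr i)). Qed.

Lemma hcomp_block (P P' Q Q' S S' : addRZ Z)
    (g : hom k Q S) (f : hom k P Q) (g' : hom k Q' S') (f' : hom k P' Q') :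
  hcomp (block_mx g 0 0 g' : hom k (add_sum Q Q') (add_sum S S'))
       (block_mx f 0 0 f' : hom k (add_sum P P') (add_sum Q Q')) =
  (block_mx (hcomp g f) 0 0 (hcomp g' f') : hom k (add_sum P P') (add_sum S S')).
Proof.
apply/matrixP => i j; rewrite [LHS]mxE /= big_split_ord /=.
rewrite -[i]splitK -[j]splitK.
have blE := (block_mxEul, block_mxEur, block_mxEdl, block_mxEdr).
case: (fintype.split i) => i'; case: (fintype.split j) => j' /=;
  (under eq_bigr => l _ do rewrite ?split_lshift ?split_rshift !blE);
  (under [X in _ + X]eq_bigr => l _ do rewrite ?split_lshift ?split_rshift !blE);
  rewrite !blE /hcomp !mxE ?split_lshift ?split_rshift.
- by rewrite [X in _ + X]big1 ?addr0 // => l _; rewrite !mxE ?(mulr0, mul0r).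
- by rewrite !big1 ?addr0 // => l _; rewrite !mxE ?(mulr0, mul0r).
- by rewrite !big1 ?addr0 // => l _; rewrite !mxE ?(mulr0, mul0r).
- by rewrite [X in X + _]big1 ?add0r // => l _; rewrite !mxE ?(mulr0, mul0r).
Qed.

Lemma hcomp_eta P (d : hom k (phi P) P) i j :
  hcomp d (eta_mor P) i j = fps_t k ^+ wind (vtx j) (succZ (vtx j)) (vtx i) * d i j.
Proof.
rewrite mxE (bigD1 j) //= mxE eqxx mulr1 big1 ?addr0 // => l lj.
by rewrite mxE (negPf lj) mulr0.
Qed.

End AddRZ.

Record MF (R : realType) (Z : set (circle R)) (k : comNzRingType) := MkMF {
  mf_base :> addRZ Z;
  mf_d : hom k mf_base mf_base;
  mf_sqr : hcomp mf_d mf_d = fps_t k *: idm k mf_base;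
  mf_factor : exists d' : hom k (phi mf_base) mf_base,
    mf_d = hcomp d' (eta_mor k mf_base) }.
Arguments MF {R} Z k.

HB.instance Definition _ (R : realType) (Z : set (circle R)) k :=
  gen_eqMixin (MF Z k).
HB.instance Definition _ (R : realType) (Z : set (circle R)) k :=
  gen_choiceMixin (MF Z k).

Section Objects.
Variables (R : realType) (Z : set (circle R)) (k : comNzRingType).
Local Notation MF := (MF Z k).

Lemma mf_zero_sqr : hcomp (0 : hom k (add_zero Z) (add_zero Z)) 0 =
  fps_t k *: idm k (add_zero Z).
Proof. by apply/matrixP => -[]. Qed.

Lemma mf_zero_factor : exists d' : hom k (phi (add_zero Z)) (add_zero Z),
  0 = hcomp d' (eta_mor k (add_zero Z)).
Proof. by exists 0; apply/matrixP => -[]. Qed.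

Definition mf_zero : MF := MkMF mf_zero_sqr mf_zero_factor.

Section Sum.
Variables X Y : MF.

Definition mf_sum_d : hom k (add_sum X Y) (add_sum X Y) :=
  block_mx (mf_d X) 0 0 (mf_d Y).

Lemma mf_sum_sqr : hcomp mf_sum_d mf_sum_d = fps_t k *: idm k (add_sum X Y).
Proof.
by rewrite hcomp_block !mf_sqr /idm [in RHS]scalar_mx_block scale_block_mx !scaler0.
Qed.

Lemma mf_sum_factor : exists d' : hom k (phi (add_sum X Y)) (add_sum X Y),
  mf_sum_d = hcomp d' (eta_mor k (add_sum X Y)).
Proof.
have [dX eX] := mf_factor X; have [dY eY] := mf_factor Y.
exists (block_mx (dX : 'M[fps k]_(rk X)) 0 0 (dY : 'M[fps k]_(rk Y))).
apply/matrixP => i j; rewrite hcomp_eta /mf_sum_d eX eY /=.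
rewrite -[i]splitK -[j]splitK.
have blE := (block_mxEul, block_mxEur, block_mxEdl, block_mxEdr).
by case: (fintype.split i) => i'; case: (fintype.split j) => j' /=;
  rewrite !blE ?split_lshift ?split_rshift ?hcomp_eta // !mxE mulr0.
Qed.

Definition mf_sum : MF := MkMF mf_sum_sqr mf_sum_factor.

End Sum.

(* The matrix factorisation on a (+) b with components f_{ba} and f_{ab}. *)
Section Pair.
Variables (a b : Z) (ab : a <> b).

Definition pair_base : addRZ Z :=
  AddRZ (fun i : 'I_2 => if i == 0 then a else b).

Definition pair_d : hom k pair_base pair_base := \matrix_(i, j) (i != j)%:R.

Lemma pair_sqr : hcomp pair_d pair_d = fps_t k *: idm k pair_base.
Proof.
have ba : b <> a by move=> e; exact: ab.
have I2 (i : 'I_2) : i = 0 \/ i = 1.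
  by case: i => -[|[|//]] h; [left|right]; apply/val_inj.
apply/matrixP => i j; rewrite mxE /= !big_ord_recl big_ord0 !mxE /=.
case: (I2 i) => ->; case: (I2 j) => ->; rewrite ?mxE /= ?(mulr0, mulr1, addr0, add0r) //.
- by rewrite wind_xyx.
- by rewrite wind_xyx.
Qed.

Lemma pair_factor : exists d' : hom k (phi pair_base) pair_base,
  pair_d = hcomp d' (eta_mor k pair_base).
Proof.
exists (pair_d : 'M[fps k]_2); apply/matrixP => i j.
rewrite hcomp_eta mxE; case: (eqVneq i j) => [_|ij]; first by rewrite mulr0.
rewrite wind_succ ?mul1r //=.
by case: i ij => -[|[|//]] hi; case: j => -[|[|//]] hj //= _ e; exact: ab.
Qed.

Definition mf_pair : MF := MkMF pair_sqr pair_factor.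

End Pair.

End Objects.

Arguments mf_zero {R} Z k.

Section Frobenius.
Variables (R : realType) (Z : set (circle R)) (k : comNzRingType).
Local Notation MF := (MF Z k).
Implicit Types A B C X Y W I : MF.

Definition mf_mor X Y : set (hom k X Y) :=
  [set f | hcomp f (mf_d X) = hcomp (mf_d Y) f].

Definition conflation X Y W (i : hom k X Y) (p : hom k Y W) : Prop :=
  [/\ mf_mor i, mf_mor p &
    exists (r : hom k Y X) (s : hom k W Y),
      [/\ hcomp r i = idm k X, hcomp p s = idm k W, hcomp p i = 0
        & hcomp i r + hcomp s p = idm k Y]].

Definition mf_projective I : Prop :=
  forall A B C (i : hom k A B) (p : hom k B C), conflation i p ->
  forall f : hom k I C, mf_mor f ->
  exists2 g : hom k I B, mf_mor g & hcomp p g = f.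

Definition mf_injective I : Prop :=
  forall A B C (i : hom k A B) (p : hom k B C), conflation i p ->
  forall f : hom k A I, mf_mor f ->
  exists2 g : hom k B I, mf_mor g & hcomp g i = f.

(* The stable category has the same objects, and morphisms modulo [stable_eq]. *)
Definition stable_eq X Y (f g : hom k X Y) : Prop :=
  exists (I : MF) (u : hom k X I) (v : hom k I Y),
    [/\ mf_projective I, mf_mor u, mf_mor v & f - g = hcomp v u].

Definition stable_iso X Y (f : hom k X Y) : Prop :=
  mf_mor f /\ exists g : hom k Y X,
    [/\ mf_mor g, stable_eq (hcomp g f) (idm k X)
      & stable_eq (hcomp f g) (idm k Y)].

Definition stably_isomorphic X Y : Prop := exists f : hom k X Y, stable_iso f.

(* A choice of the suspension of X; it is unique up to unique isomorphism in
   the stable category. *)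
Record suspension X := Suspension {
  susp_hull : MF;
  susp_obj : MF;
  susp_in : hom k X susp_hull;
  susp_out : hom k susp_hull susp_obj;
  susp_injective : mf_injective susp_hull;
  susp_conflation : conflation susp_in susp_out }.

(* s represents the suspension of the morphism represented by f. *)
Definition susp_mor X X' (S : suspension X) (S' : suspension X')
    (f : hom k X X') (s : hom k (susp_obj S) (susp_obj S')) : Prop :=
  mf_mor s /\ exists h : hom k (susp_hull S) (susp_hull S'),
    [/\ mf_mor h, hcomp h (susp_in S) = hcomp (susp_in S') f
      & hcomp s (susp_out S) = hcomp (susp_out S') h].

(* The rows of the diagram
     X --> I --> Sigma X
     |u    |h      ||
     Y --> C --> Sigma X
   are conflations, so that its left square is a pushout. *)
Definition standard_triangle X Y C (S : suspension X)
    (u : hom k X Y) (v : hom k Y C) (w : hom k C (susp_obj S)) : Prop :=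
  [/\ mf_mor u, conflation v w & exists h : hom k (susp_hull S) C,
    [/\ mf_mor h, hcomp h (susp_in S) = hcomp v u & hcomp w h = susp_out S]].

Definition distinguished X Y W (S : suspension X)
    (u : hom k X Y) (v : hom k Y W) (w : hom k W (susp_obj S)) : Prop :=
  [/\ mf_mor u, mf_mor v, mf_mor w &
  exists (X' Y' W' : MF) (S' : suspension X')
    (u' : hom k X' Y') (v' : hom k Y' W') (w' : hom k W' (susp_obj S'))
    (a : hom k X X') (b : hom k Y Y') (c : hom k W W')
    (s : hom k (susp_obj S) (susp_obj S')),
    [/\ standard_triangle u' v' w',
        [/\ stable_iso a, stable_iso b, stable_iso c & susp_mor a s]
      & [/\ stable_eq (hcomp b u) (hcomp u' a),
            stable_eq (hcomp c v) (hcomp v' b)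
          & stable_eq (hcomp s w) (hcomp w' c)]]].

(* The object {a, b}, which is zero when {a, b} is an edge. *)
Definition diag_obj (a b : Z) : MF :=
  if pselect (is_diagonal a b) is left h then mf_pair k (proj1 h)
  else mf_zero Z k.

Definition diag_sum (l : seq (Z * Z)) : MF :=
  foldr (fun ab X => mf_sum (diag_obj ab.1 ab.2) X) (mf_zero Z k) l.

(* Direct summands, in the stable category, of finite direct sums of
   diagonals in T. *)
Definition addT (T : set (set Z)) : set MF :=
  [set X | exists (Y : MF) (l : seq (Z * Z)),
    (forall ab, ab \in l -> T [set ab.1; ab.2]) /\
    stably_isomorphic (mf_sum X Y) (diag_sum l)].

End Frobenius.

Section Index.
Variables (R : realType) (Z : set (circle R)) (k : comNzRingType).
Variable T : set (set Z).

Local Notation Tobj := (set_type (@addT R Z k T)).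

Definition split_relation : set {freeg Tobj / int} :=
  [set v | exists A B C : Tobj,
    stably_isomorphic (sval C) (mf_sum (sval A) (sval B)) /\
    v = << C >> - << A >> - << B >>].

(* The intersection of the subgroups containing [split_relation]. *)
Definition split_subgroup : {pred {freeg Tobj / int}} :=
  fun v => `[< forall N : set {freeg Tobj / int},
    N 0 -> (forall x y, N x -> N y -> N (x - y)) ->
    split_relation `<=` N -> N v >].

Lemma split_subgroup_closed : zmod_closed split_subgroup.
Proof.
split; first by apply/asboolP.
move=> x y /asboolP hx /asboolP hy; apply/asboolP => N N0 NB Nr.
by apply: (NB); [exact: hx | exact: hy].
Qed.

HB.instance Definition _ :=
  GRing.isZmodClosed.Build _ split_subgroup split_subgroup_closed.

Definition K0split : Type := Quotient.quot split_subgroup.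
HB.instance Definition _ :=
  GRing.Zmodule.copy K0split (Quotient.quot split_subgroup).

Definition K0class_of (X : Tobj) : K0split :=
  \pi_(Quotient.quot split_subgroup)%qT << X >>.

(* Only meaningful for objects of add T. *)
Definition K0class (X : MF Z k) : K0split :=
  if pselect (addT T X) is left h then K0class_of (exist _ X (mem_set h))
  else 0.

(* [t0] - [t1], for a distinguished triangle t1 -> t0 -> s -> Sigma t1 chosen
   by [xget]; the value 0 would only occur if there were no such triangle. *)
Definition ind (s : MF Z k) : K0split :=
  xget 0 [set v | exists (t0 t1 : Tobj) (S : suspension (sval t1))
    (a : hom k (sval t1) (sval t0)) (b : hom k (sval t0) s)
    (c : hom k s (susp_obj S)),
    distinguished a b c /\ v = K0class_of t0 - K0class_of t1].

End Index.

(* Main.v *)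
(* C(Z) is the stable category of matrix factorisations of t over add RZ. A conflation
   X -> B -> W with X and B stably in add T computes the index of W, because Ext^1 vanishes
   between objects of add T: comparing two such conflations by lifting through them gives
   X + B' = X' + B stably (Schanuel), which is all that K_0^split sees. Here Ext^1 between
   the factorisations {a, b} and {c, d} is given by linear systems in powers of t and
   vanishes unless a < c < b < d < a or a < d < b < c < a.

   For vertices in the cyclic order a < b < d < c there is an exchange conflation
   {b, c} -> {a, b} + {c, d} -> {a, d}. Along the zig-zag path,
   e < e_1 < e_3 < ... <= f < ... < e_4 < e_2, so that the exchange conflations
   {e_{2j-1}, e_{2j}} -> {e, e_{2j-1}} + {e_{2j}, e_{2j+1}} -> {e, e_{2j+1}} splice into
   one from the sum of the odd terms through the sum of the even terms to {e, f}; the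
   splicing uses Ext^1 = 0 once more. An edge {z, z^+} gives a projective object. *)

Require Import Defs.
From mathcomp Require Import all_boot all_order all_algebra.
From mathcomp Require Import all_classical all_reals all_analysis.
From mathcomp.multinomials Require Import freeg.
From mathcomp Require Import ring lra zify.
Import Defs.

Set Implicit Arguments.
Unset Strict Implicit.
Unset Printing Implicit Defensive.

Import Order.TTheory GRing.Theory Num.Theory.
Import numFieldNormedType.Exports.

Local Open Scope classical_set_scope.
Local Open Scope ring_scope.

(** * The cyclic order *)

Section Angles.
Variable R : realType.
Implicit Types (x y p : circle R) (a b c : R).

(** Stable equality quantifies over an unknown projective object, so it cannot be computed with
    directly. The working criterion is [null]: an object is projective, and likewise injective,
    exactly when its identity is null-homotopic. The harder direction needs, for each object, a
    contractible object mapping onto it and another containing it. Both come from one extension of a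
    factorisation on Q by one on [phi Q], and writing an arbitrary object over some [phi Q] requires
    every vertex to be a successor. This is why immediate neighbours on both sides must first be
    produced from discreteness and two-sided limits.

    A distinguished triangle is only given up to stable isomorphism of its vertices, whereas
    Schanuel's argument needs a genuine conflation. Adding the injective hull of the first vertex to
    the middle term produces one without changing any stable class.

    Composition sees the cyclic order only through the exponents [wind], a 2-cocycle. Angles
    measured from a cut serve to compute these exponents; afterwards order arguments become
    comparisons of powers of t. *)

Definition angle_from a p : R := sval (cid2 (circle_pt_window a p)).

Lemma angle_fromK a p : circle_pt (angle_from a p) = p.
Proof. by rewrite /angle_from; case: cid2. Qed.

Lemma angle_from_bounds a p : a <= angle_from a p < a + pi *+ 2.
Proof. by rewrite /angle_from; case: cid2. Qed.

Lemma circle_pt_inj_window (x0 a b : R) :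
  x0 <= a < x0 + pi *+ 2 -> x0 <= b < x0 + pi *+ 2 ->
  circle_pt a = circle_pt b -> a = b.
Proof.
move=> ha hb eab; case: (leP a b) => ab.
  by apply: circle_pt_inj_lt2pi => //; lra.
by apply/esym/circle_pt_inj_lt2pi => //; lra.
Qed.

Lemma angle_from_pt (x0 a : R) : x0 <= a < x0 + pi *+ 2 ->
  angle_from x0 (circle_pt a) = a.
Proof.
move=> ha; apply: (circle_pt_inj_window (angle_from_bounds _ _) ha).
exact: angle_fromK.
Qed.

Lemma angle_from_inj (x0 : R) : injective (angle_from x0).
Proof. by move=> x y e; rewrite -(angle_fromK x0 x) e angle_fromK. Qed.

(** The difference of two angles of one point has cosine 1 and sine 0, so adding it moves no point;
    no explicit multiple of 2 pi has to be found. *)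
Lemma circle_pt_shift a b c : circle_pt a = circle_pt b ->
  circle_pt (c + (a - b)) = circle_pt c.
Proof.
move=> [ec es].
have hc : cos (a - b) = 1 by rewrite cosB ec es -!expr2 cos2Dsin2.
have hs : sin (a - b) = 0 by rewrite sinB ec es mulrC subrr.
by apply/val_inj; rewrite /= (cosD c) (sinD c) hc hs !mulr1 !mulr0 subr0 addr0.
Qed.

Lemma ccw_arc_from a x y p : x = circle_pt a ->
  ccw_arc x y p <-> angle_from a p <= angle_from a y.
Proof.
move=> xa; split=> [[a' [th [b [xa' -> -> [h1 h2 h3]]]]]|le_py]; last first.
  exists a, (angle_from a p), (angle_from a y); rewrite !angle_fromK.
  by split=> //; split=> //; [case/andP: (angle_from_bounds a p)
    |case/andP: (angle_from_bounds a y)].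
have eaa : circle_pt a = circle_pt a' by rewrite -xa.
rewrite -(circle_pt_shift th eaa) -(circle_pt_shift b eaa).
by rewrite !angle_from_pt; lra.
Qed.

Lemma angle_from_shift (x0 : R) a p : x0 <= a < x0 + pi *+ 2 ->
  angle_from a p = angle_from x0 p + (if a <= angle_from x0 p then 0 else pi *+ 2).
Proof.
move=> ha; have hp := angle_from_bounds x0 p.
rewrite -{1}(angle_fromK x0 p); case: ifP => h.
  by rewrite addr0 angle_from_pt //; lra.
by rewrite -circle_pt_periodic angle_from_pt //; lra.
Qed.

(** Cutting the circle at x0 turns an arc into an interval of angles or, if the arc runs through the
    cut, into two end pieces. Statements about arcs then become linear arithmetic. *)
Lemma ccw_arcE (x0 : R) x y p : ccw_arc x y p <->
  let a := angle_from x0 x in let b := angle_from x0 y in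
  let c := angle_from x0 p in
  (a <= c <= b) || ((b < a) && ((a <= c) || (c <= b))).
Proof.
have hx := angle_from_bounds x0 x; have hy := angle_from_bounds x0 y.
have hp := angle_from_bounds x0 p.
rewrite (ccw_arc_from y p (esym (angle_fromK x0 x))) !(angle_from_shift _ hx) /=.
move: hx hy hp; move: (angle_from x0 x) (angle_from x0 y) (angle_from x0 p) => a b c.
move=> ha hb hc.
by case: (leP a b) => h1; case: (leP a c) => h2 /=; rewrite ?addr0 ?andbT ?andbF ?orbF ?lerD2r;
 split=> //; try lra; move=> h; lra.
Qed.

End Angles.

Section Wind.
Variables (R : realType) (Z : set (circle R)).
Implicit Types a b c d z w : Z.

(* [wind] is the coboundary of the indicator of the moves that cross the cut at angle x0. *)
Lemma wind_cut (x0 : R) a b c : let th z := angle_from x0 (sval z) in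
  (wind a b c + (th c < th a)%R = (th b < th a)%R + (th c < th b)%R)%N.
Proof.
move=> th.
have -> : wind a b c = ((th a <= th c <= th b) ||
    ((th b < th a) && ((th a <= th c) || (th c <= th b)))) && (th c != th b) :> nat.
  congr nat_of_bool; apply/asboolP/andP => -[/(ccw_arcE x0) h1 h2]; split=> //.
    by apply: contra_not_neq h2 => /angle_from_inj/val_inj.
  by move=> e; rewrite e eqxx in h2.
move: (th a) (th b) (th c) => {}a {}b {}c.
by case: (ltgtP a b); case: (ltgtP b c); case: (ltgtP a c) => //=;
  move=> *; subst; rewrite ?ltxx //=; exfalso; lra.
Qed.

(** A coboundary is a cocycle: the cut-crossing terms of the four instances of [wind_cut] cancel. *)
Lemma wind_cocycle a b c d :
  (wind a b c + wind a c d = wind a b d + wind b c d)%N.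
Proof.
move: (wind_cut 0 a b c) (wind_cut 0 a c d) (wind_cut 0 a b d) (wind_cut 0 b c d) => /=.
lia.
Qed.

Lemma wind_xyy a b : wind a b b = 0%N.
Proof. by rewrite /wind asboolF // => -[]. Qed.

Lemma wind_le1 a b c : (wind a b c <= 1)%N.
Proof. by rewrite /wind; case: asboolP. Qed.

End Wind.

(** * Immediate neighbours in Z *)

Section Neighbours.
Variables (R : realType) (Z : set (circle R)).

Lemma angles_limit (m : R) (A : set R) :
  (forall e, 0 < e -> exists x, [/\ A x, circle_pt x <> circle_pt m & `|m - x| < e]) ->
  (forall x, A x -> Z (circle_pt x)) -> is_limit Z (circle_pt m).
Proof.
move=> hA AZ U hU.
have hc : (fun x : R => (cos x, sin x)) @ m --> (cos m, sin m).
  exact: cvg_pair (@continuous_cos R m) (@continuous_sin R m).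
have /nbhs_ballP[e /= e0 he] := hc _ hU.
have [x [Ax xm dx]] := hA e e0.
exists (cos x, sin x); split.
- by apply: contra_not_neq xm => h; apply/val_inj.
- by exists (circle_pt x) => //; exact: AZ.
- exact: (he x).
Qed.

Hypothesis hdiscrete : forall z, Z z -> ~ is_limit Z z.
Hypothesis htwosided : forall y, is_limit Z y -> two_sided_limit Z y.

Let dir (s : bool) (x : R) := if s then x else - x.

(** The infimum m of the distances from a to other points of Z in the direction s is attained.
    Otherwise the point at distance m is a limit point: for m = 0 this contradicts discreteness at
    a, and for m > 0 two-sidedness gives points of Z at distance less than m. *)
Lemma nearest s (a th : R) : Z (circle_pt a) ->
  0 < th < pi *+ 2 -> Z (circle_pt (a + dir s th)) ->
  exists m, [/\ 0 < m < pi *+ 2, Z (circle_pt (a + dir s m))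
    & forall x, 0 < x < m -> ~ Z (circle_pt (a + dir s x))].
Proof.
move=> Za hth Zth.
pose S := [set x | 0 < x < pi *+ 2 /\ Z (circle_pt (a + dir s x))].
have Sth : S th by [].
have S0 : lbound S 0 by move=> x [/andP[x0 _] _]; exact: ltW.
have hS : has_inf S by split; [exists th | exists 0].
set m := inf S.
have m_lb x : S x -> m <= x by apply: ge_inf; exists 0.
have m0 : 0 <= m by apply: lb_le_inf => //; exists th.
have m2 : m < pi *+ 2 by have := m_lb _ Sth; lra.
have hmin x : 0 < x < m -> ~ Z (circle_pt (a + dir s x)).
  move=> hx Zx; have /m_lb : S x by split=> //; lra.
  by lra.
have [Sm|NSm] := pselect (S m).
  by exists m; split=> //; case: Sm.
have dirE x y : `|a + dir s x - (a + dir s y)| = `|x - y|.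
  rewrite opprD addrACA subrr add0r /dir; case: ifP => _ //.
  by rewrite opprK -[RHS]normrN opprB addrC.
have lim : is_limit Z (circle_pt (a + dir s m)).
  apply: (@angles_limit _ [set a + dir s x | x in S]); last by move=> _ [x [_ ?] <-].
  move=> e e0; have [x Sx xe] := inf_adherent e0 hS.
  have mx : m < x.
    by have := m_lb _ Sx; rewrite le_eqVlt => /orP[/eqP ex|//]; rewrite -ex in Sx.
  exists (a + dir s x); split; first by exists x.
    have [hx2 _] := Sx; rewrite /dir; case: (s) => /eqP; first move=> /eqP h.
      by have := @circle_pt_inj_lt2pi R (a + m) (a + x) _ (esym h); lra.
    move=> /eqP h.
    by have := @circle_pt_inj_lt2pi R (a - x) (a - m) _ h; lra.
  by rewrite dirE distrC gtr0_norm ?subr_gt0 // ltrBlDl.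
move: m0; rewrite le_eqVlt => /orP[/eqP m0|m0].
  case: (hdiscrete Za); have -> // : a = a + dir s m.
  by rewrite -m0 /dir; case: ifP; rewrite ?oppr0 addr0.
(* The side of the limit point that faces a is [~~ s]. *)
have [u Zu [c [t [ec t0 tlim ut]]]] := htwosided lim (~~ s).
have /cvgr_lt /(_ m m0) [N _ /(_ N (leqnn N)) /= tm] := tlim.
have tN := t0 N.
exfalso; apply: (hmin (m - t N)); first by lra.
have := Zu N; rewrite ut.
have -> : (if ~~ s then c + t N else c - t N) = (a + dir s (m - t N)) + (c - (a + dir s m)).
  by rewrite /dir; case: (s) => /=; ring.
by rewrite circle_pt_shift.
Qed.

Variables e f : Z.
Hypothesis ef : e <> f.

Lemma other_point (z : Z) : exists w : Z, w <> z.
Proof.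
have [->|ez] := pselect (z = e); first by exists f => /esym.
by exists e => /esym.
Qed.

(** Once a nearest point exists, the [xget] in [succZ] does not return its default value. *)
Lemma succZ_spec (z : Z) : succZ z <> z /\
  forall v : Z, ccw_arc (sval z) (sval (succZ z)) (sval v) -> v = z \/ v = succZ z.
Proof.
apply: (xgetPex z (P := [set w : Z | w <> z /\
  forall v : Z, ccw_arc (sval z) (sval w) (sval v) -> v = z \/ v = w])).
have [w wz] := other_point z.
set a := angle_from 0 (sval z); have za : sval z = circle_pt a by rewrite angle_fromK.
have pi0 := pi_gt0 R.
have aza : angle_from a (sval z) = a by rewrite za angle_from_pt //; lra.
have off (v : Z) : v <> z -> a < angle_from a (sval v) < a + pi *+ 2.
  move=> vz; have /andP[h1 ->] := angle_from_bounds a (sval v); rewrite andbT.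
  rewrite lt_neqAle h1 andbT; apply: contra_not_neq vz => h.
  by apply/val_inj/(@angle_from_inj _ a); rewrite aza.
have [] := @nearest true a (angle_from a (sval w) - a).
- by rewrite -za; exact: set_valP.
- by have := off _ wz; lra.
- by rewrite /= addrC subrK angle_fromK; exact: set_valP.
move=> m [hm Zm hmin]; exists (exist (fun x => x \in Z) _ (mem_set Zm) : Z); split.
  move=> /(congr1 (fun z : Z => angle_from a (sval z))) /=.
  by rewrite aza angle_from_pt; lra.
move=> v /(ccw_arc_from _ _ za) /=; rewrite angle_from_pt; last by lra.
move=> hv; have [->|vz] := pselect (v = z); [by left | right].
have hv' := off _ vz.
apply/val_inj/(@angle_from_inj _ a); rewrite /= angle_from_pt; last by lra.
apply/eqP; rewrite eq_le hv /= leNgt; apply/negP => h.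
apply: (hmin (angle_from a (sval v) - a)); first by lra.
by rewrite /= addrC subrK angle_fromK; exact: set_valP.
Qed.

Lemma predZ_spec (z : Z) : predZ z <> z /\
  forall v : Z, ccw_arc (sval (predZ z)) (sval z) (sval v) -> v = predZ z \/ v = z.
Proof.
apply: (xgetPex z (P := [set w : Z | w <> z /\
  forall v : Z, ccw_arc (sval w) (sval z) (sval v) -> v = w \/ v = z])).
have [w wz] := other_point z.
set a := angle_from 0 (sval z); have za : sval z = circle_pt a by rewrite angle_fromK.
have pi0 := pi_gt0 R.
have za2 : sval z = circle_pt (a + pi *+ 2) by rewrite circle_pt_periodic.
have aza : angle_from a (sval z) = a by rewrite za angle_from_pt //; lra.
have off (v : Z) : v <> z -> a < angle_from a (sval v) < a + pi *+ 2.
  move=> vz; have /andP[h1 ->] := angle_from_bounds a (sval v); rewrite andbT.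
  rewrite lt_neqAle h1 andbT; apply: contra_not_neq vz => h.
  by apply/val_inj/(@angle_from_inj _ a); rewrite aza.
(* Here z gets the angle a + 2 pi and distances are measured downwards from it, so that all angles
   stay in the window starting at a. *)
have [] := @nearest false (a + pi *+ 2) (a + pi *+ 2 - angle_from a (sval w)).
- by rewrite -za2; exact: set_valP.
- by have := off _ wz; lra.
- by rewrite /= opprB addrC subrK angle_fromK; exact: set_valP.
move=> m [hm /= Zm hmin]; exists (exist (fun x => x \in Z) _ (mem_set Zm) : Z); split.
  move=> /(congr1 (fun z : Z => angle_from a (sval z))) /=.
  by rewrite aza angle_from_pt; lra.
move=> v /(ccw_arcE a) /=; rewrite aza angle_from_pt; last by lra.
move=> hv; have [->|vz] := pselect (v = z); [by right | left].
have hv' := off _ vz.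
apply/val_inj/(@angle_from_inj _ a); rewrite /= angle_from_pt; last by lra.
apply/eqP; rewrite eq_le; apply/andP; split; last by case/orP: hv; lra.
rewrite leNgt; apply/negP => h.
apply: (hmin (a + pi *+ 2 - angle_from a (sval v))); first by lra.
by rewrite /= opprB addrC subrK angle_fromK; exact: set_valP.
Qed.

(** Of z and the successor of its predecessor, one lies on the arc from the predecessor to the
    other, and that arc contains only its ends. *)
Lemma predZK (z : Z) : succZ (predZ z) = z.
Proof.
have [h1 h2] := predZ_spec z; have [h3 h4] := succZ_spec (predZ z).
have : ccw_arc (sval (predZ z)) (sval z) (sval (succZ (predZ z))) \/
  ccw_arc (sval (predZ z)) (sval (succZ (predZ z))) (sval z).
  have ea := esym (angle_fromK 0 (sval (predZ z))).
  rewrite !(ccw_arc_from _ _ ea).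
  by apply/orP; exact: le_total.
by case=> [/h2|/h4] [] // e'; case: h1.
Qed.

End Neighbours.

(* [arc x y v] describes [ccw_arc] on the circle cut open at a point below all angles. *)
Section CyclicOrder.
Variable R : realType.
Implicit Types a b c d g : R.
Local Notation arc x y v := ((x <= v <= y) || ((y < x) && ((x <= v) || (v <= y)))).

Lemma cyc_after a b c : a < b -> c != a -> ~~ arc a c b -> a < c <= b.
Proof. by case: (ltgtP a b); case: (ltgtP b c); case: (ltgtP a c) => //= *; lra. Qed.

Lemma cyc_one a b d : a < d -> arc d d b -> a < b.
Proof. by rewrite ltxx /= orbF => *; lra. Qed.

Lemma cyc_top a b c d g : a < d -> c < g -> c <= d -> c <= b ->
  ~~ arc g c d -> arc d g b -> a < b.
Proof. by case: (ltP g d) => /= *; lra. Qed.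

Lemma cyc_mid a b c d g : a < d -> d <= c -> c != d -> a < c -> g != c ->
  ~~ arc g c d -> arc d g b -> a < b.
Proof. by case: (ltP g d) => /= *; lra. Qed.

End CyclicOrder.

(** * Angles along the zig-zag path *)

Section ZigzagOrder.
Variables (R : realType) (Z : set (circle R)) (T : set (set Z)).
Hypothesis succ_spec : forall z : Z, succZ z <> z /\
  forall v : Z, ccw_arc (sval z) (sval (succZ z)) (sval v) -> v = z \/ v = succZ z.
Hypothesis pred_spec : forall z : Z, predZ z <> z /\
  forall v : Z, ccw_arc (sval (predZ z)) (sval z) (sval v) -> v = predZ z \/ v = z.
Variables (e f : Z) (i : nat) (p : nat -> Z).
Hypotheses (ef : e <> f) (hp : zigzag T e f i p).

Let th (z : Z) := angle_from (angle_from 0 (sval e)) (sval z).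

Let th_inj : injective th.
Proof. by move=> x y /angle_from_inj/val_inj. Qed.

Let th_e z : th e <= th z.
Proof.
have /andP[h _] := angle_from_bounds (angle_from 0 (sval e)) (sval z).
apply: le_trans h; rewrite /th -{2}(angle_fromK 0 (sval e)) angle_from_pt //.
by have := pi_gt0 R; lra.
Qed.

Let arcE x y v : ccw_arc (sval x) (sval y) (sval v) <->
  (th x <= th v <= th y) || ((th y < th x) && ((th x <= th v) || (th v <= th y))).
Proof. exact: ccw_arcE. Qed.

Let th_neq x y : x <> y -> th x != th y.
Proof. by move=> xy; apply: contra_not_neq xy => /th_inj. Qed.

Let th_lt_e z : z <> e -> th e < th z.
Proof. by move=> ze; rewrite lt_neqAle th_e andbT th_neq //; exact: nesym. Qed.

Let th_succ z v : th z < th v -> th z < th (succZ z) <= th v.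
Proof.
move=> zv; have [h1 h2] := succ_spec z; have n1 := th_neq h1.
have [ev|nv] := pselect (v = succZ z); first by rewrite -ev zv lexx.
have : ~ ccw_arc (sval z) (sval (succZ z)) (sval v).
  by move=> /h2[vz|//]; rewrite vz ltxx in zv.
rewrite arcE => /negP; exact: cyc_after.
Qed.

Let last_in_end x y (Q : Z -> Prop) v : last_in x y Q v -> Q y -> v = y.
Proof.
move=> [h1 _ h3] Qy; have [_ yy] := ccw_arc_ends (sval x) (sval y).
have := h3 y yy Qy; move: h1.
rewrite !(ccw_arc_from _ _ (esym (angle_fromK 0 (sval x)))) => h h'.
apply/val_inj/(@angle_from_inj _ (angle_from 0 (sval x))).
by apply/le_anti; rewrite h h'.
Qed.

(** With the circle cut at e, the search range from f^+ to q^- stays beyond f. It would wrap around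
    if q were f^+, hence that hypothesis. The cases are a range consisting of one point, a range
    ending just before the cut (q = e), and one ending before a vertex q beyond f. *)
Let th_succ_f q : q <> f -> q <> succZ f -> (q = e \/ th f < th q) ->
  forall v, ccw_arc (sval (succZ f)) (sval (predZ q)) (sval v) -> th f < th v.
Proof.
move=> qf qs hq v; have [s1 s2] := succ_spec f; have [p1 p2] := pred_spec q.
have ns := th_neq s1; have nq := th_neq qs.
have sf : th f < th (succZ f).
  case: hq => [qe|/th_succ/andP[] //].
  rewrite lt_neqAle eq_sym ns leNgt; apply/negP => h.
  have /s2[] : ccw_arc (sval f) (sval (succZ f)) (sval e); [|exact: ef|by rewrite -qe].
  by rewrite arcE h /= th_e !orbT.
have sq : ~ ccw_arc (sval (predZ q)) (sval q) (sval (succZ f)) \/ succZ f = predZ q.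
  have [/p2[h|/esym h]|h] :=
    pselect (ccw_arc (sval (predZ q)) (sval q) (sval (succZ f))); by [right|case: qs|left].
case: sq => [sq|<-]; last by rewrite arcE; exact: cyc_one.
move: sq; rewrite !arcE.
case: hq => [qe|fq].
  have := th_e v; have := th_e (succZ f); have := th_lt_e (z := predZ q).
  by rewrite -qe => /(_ p1) => h1 h2 h3 /negP; exact: cyc_top.
have /th_succ/andP[_ sq'] := fq.
by move=> /negP; apply: cyc_mid => //; exact: th_neq.
Qed.

(* Writing th for the angle measured from e, the path satisfies
   th e < th e_1 < th e_3 < ... <= th f < th e_{2j} for j > 0. *)
Lemma zigzag_angles n : (n <= i)%N ->
  [/\ th e < th (p n.*2.+1) <= th f, p n.*2 = e \/ th f < th (p n.*2)
    & exists x, last_in x f (linked T (p n.*2)) (p n.*2.+1)] /\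
  (forall m, (m < n)%N -> [/\ th (p m.*2.+1) < th (p m.*2.+3), th f < th (p m.*2.+2),
     T [set p m.*2.+1; p m.*2.+2] & linked T (p m.*2.+2) (p m.*2.+3)]).
Proof.
have [p0 l1 hstep pf] := hp.
elim: n => [|n IH] hn.
  split=> //; split; [|by left|by exists (succZ (p 0%N)); exact: l1].
  have := th_succ (th_lt_e (nesym ef)); case: l1 => + _ _.
  by rewrite p0 arcE; move=> h1 h2; case/orP: h1; lra.
have [[hA hB [x hL]] hm] := IH (ltnW hn).
have [nf fst lst] := hstep n.+1 hn; rewrite doubleS /= in nf fst lst.
(* If e_{2n} were f^+, it would be joined to f by an edge, the last linked vertex would be f, and
   the path would already have stopped. *)
have qs : p n.*2 <> succZ f.
  move=> h; apply: nf; apply: (last_in_end hL); left; split; last by right.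
  by rewrite h; case: (succ_spec f).
have qf : p n.*2 <> f by case: hB => [->|] // + h; rewrite h ltxx.
have f2 : th f < th (p n.*2.+2) by case: fst => /(th_succ_f qf qs hB).
have b1 : th (p n.*2.+1) < th f.
  by case/andP: hA => _; rewrite le_eqVlt => /orP[/eqP/th_inj|].
have d1 : th (p n.*2.+1) < th (p n.*2.+3) <= th f.
  by have := th_succ b1; case: lst; rewrite arcE => h1 _ _ h2; case/orP: h1; lra.
have hl : linked T (p n.*2.+2) (p n.*2.+3) by case: lst.
rewrite doubleS; split.
  split; [by lra | by right | by exists (succZ (p n.*2.+1))].
move=> m; rewrite ltnS leq_eqVlt => /orP[/eqP ->|/hm//].
by split=> //; [case/andP: d1|case: fst].
Qed.

(** The cyclic order of e, e_{2m+1}, e_{2m+3}, e_{2m+2} is recorded by the exponents of its four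
    consecutive triples, the form in which matrix products use it. *)
Lemma zigzag_order :
  [/\ p 0%N = e, p i.*2.+1 = f, linked T (p 0%N) (p 1%N),
    (forall m, (m <= i)%N -> p 0%N <> p m.*2.+1)
   & forall m, (m < i)%N -> [/\ T [set p m.*2.+1; p m.*2.+2],
     linked T (p m.*2.+2) (p m.*2.+3), p 0%N <> p m.*2.+2, p m.*2.+2 <> p m.*2.+3
     & p m.*2.+1 <> p m.*2.+3 /\
       [/\ wind (p 0%N) (p m.*2.+1) (p m.*2.+3) = 0,
        wind (p m.*2.+1) (p m.*2.+3) (p m.*2.+2) = 0,
        wind (p m.*2.+3) (p m.*2.+2) (p 0%N) = 0 &
        wind (p m.*2.+2) (p 0%N) (p m.*2.+1) = 0]%N]].
Proof.
have [p0 [_ l01 _] _ pf] := hp; split=> //.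
  move=> m /zigzag_angles[[/andP[h _] _ _] _] e0.
  by rewrite -e0 p0 ltxx in h.
move=> m mi; have [[/andP[ha _] _ _] _] := zigzag_angles (ltnW mi).
have [[/andP[_ hf] _ _] /(_ m (ltnSn m))[hbd hc hT hl]] := zigzag_angles mi.
have lt_neq x y : th x < th y -> x <> y by move=> + xy; rewrite xy ltxx.
rewrite doubleS in hf; have dc := le_lt_trans hf hc.
have ad := lt_trans ha hbd; have ac := lt_trans ad dc; have bc := lt_trans hbd dc.
rewrite p0; split=> //; [exact: lt_neq|exact/nesym/lt_neq|split; first exact: lt_neq].
have W x y z : (wind x y z + (th z < th x)%R = (th y < th x)%R + (th z < th y)%R)%N.
  exact: wind_cut.
split.
- have := W e (p m.*2.+1) (p m.*2.+3); rewrite (lt_gtF ad) (lt_gtF ha) (lt_gtF hbd); lia.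
- have := W (p m.*2.+1) (p m.*2.+3) (p m.*2.+2).
  rewrite (lt_gtF bc) (lt_gtF hbd) (lt_gtF dc); lia.
- have := W (p m.*2.+3) (p m.*2.+2) e; rewrite ac ad (lt_gtF dc); lia.
- have := W (p m.*2.+2) e (p m.*2.+1); rewrite ac bc (lt_gtF ha); lia.
Qed.

End ZigzagOrder.

(** * Matrices over add RZ *)

Section DivisibilityByT.
Variable k : comNzRingType.
Local Notation t := (fps_t k).
Implicit Types x y : fps k.

Lemma fps_t_mul x n : (t * x) n = if n is m.+1 then x m else 0.
Proof.
change ((t * x) n) with (fps_mul t x n); rewrite /fps_mul big_ord_recl /=.
case: n => [|n]; first by rewrite big_ord0 mul0r addr0.
rewrite mul0r add0r big_ord_recl /= mul1r subSS subn0 big1 ?addr0 // => i _.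
by rewrite /fps_t /= mul0r.
Qed.

(** Multiplication by t shifts coefficients. Identities may therefore be checked after multiplying
    by t, which replaces working over k((t)). *)
Lemma fps_t_cancel x y : t * x = t * y -> x = y.
Proof.
move=> e; apply/funext => n.
by have := congr1 (fun z : fps k => z n.+1) e; rewrite !fps_t_mul.
Qed.

Lemma fps_tX_cancel n x y : t ^+ n * x = t ^+ n * y -> x = y.
Proof.
elim: n => [|n IH]; first by rewrite !mul1r.
by rewrite exprS -!mulrA => /fps_t_cancel.
Qed.

Definition dvdt x := exists y, x = t * y.

Lemma dvdt0 : dvdt 0.
Proof. by exists 0; rewrite mulr0. Qed.

Lemma dvdtt : dvdt t.
Proof. by exists 1; rewrite mulr1. Qed.

Lemma dvdtD x y : dvdt x -> dvdt y -> dvdt (x + y).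
Proof. by move=> [a ->] [b ->]; exists (a + b); rewrite mulrDr. Qed.

Lemma dvdtN x : dvdt x -> dvdt (- x).
Proof. by move=> [a ->]; exists (- a); rewrite mulrN. Qed.

Lemma dvdtMr x y : dvdt y -> dvdt (x * y).
Proof. by move=> [a ->]; exists (x * a); rewrite mulrCA. Qed.

Lemma dvdtMl x y : dvdt x -> dvdt (x * y).
Proof. by move=> [a ->]; exists (a * y); rewrite mulrA. Qed.

Lemma dvdt_sum (I : Type) (r : seq I) (F : I -> fps k) :
  (forall i, dvdt (F i)) -> dvdt (\sum_(i <- r) F i).
Proof. by move=> h; elim/big_ind: _ => //; [exact: dvdt0 | exact: dvdtD]. Qed.

Lemma mx_dvdt m n (M : 'M[fps k]_(m, n)) :
  (forall i j, dvdt (M i j)) -> exists N : 'M[fps k]_(m, n), M = t *: N.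
Proof.
move=> h; have /choice[g hg] : forall ij : 'I_m * 'I_n, exists y, M ij.1 ij.2 = t * y.
  by move=> ij; exact: h.
by exists (\matrix_(i, j) g (i, j)); apply/matrixP => i j; rewrite !mxE -hg.
Qed.

Lemma scalet_cancel m n (M N : 'M[fps k]_(m, n)) : t *: M = t *: N -> M = N.
Proof.
move=> e; apply/matrixP => i j; apply: fps_t_cancel.
by have := congr1 (fun A : 'M[fps k]_(m, n) => A i j) e; rewrite /= !mxE.
Qed.

End DivisibilityByT.

Declare Scope hcomp_scope.
Notation "g ** f" := (hcomp g f) (at level 40, left associativity) : hcomp_scope.
Local Open Scope hcomp_scope.

Section Additive.
Variables (R : realType) (Z : set (circle R)) (k : comNzRingType).
Implicit Types P Q S V : addRZ Z.
Local Notation t := (fps_t k).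

(** Entry by entry, the exponents of the two bracketings agree by [wind_cocycle]. *)
Lemma hcompA P Q S V (h : hom k S V) (g : hom k Q S) (f : hom k P Q) :
  h ** (g ** f) = h ** g ** f.
Proof.
apply/matrixP => i j; rewrite !mxE.
under eq_bigr do rewrite mxE big_distrr /=.
rewrite exchange_big /=; apply: eq_bigr => m _.
rewrite mxE big_distrr /= big_distrl /=; apply: eq_bigr => l _.
have := wind_cocycle (vtx j) (vtx m) (vtx l) (vtx i).
move=> /(congr1 (fun n => t ^+ n)); rewrite !exprD => e.
transitivity (t ^+ wind (vtx j) (vtx m) (vtx l) * t ^+ wind (vtx j) (vtx l) (vtx i) *
  (h i l * g l m * f m j)); first by ring.
by rewrite e; ring.
Qed.

Lemma hcomp1 P Q (f : hom k P Q) : f ** idm k P = f.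
Proof.
apply/matrixP => i j; rewrite mxE (bigD1 j) //= mxE eqxx mulr1 wind_xx mul1r.
by rewrite big1 ?addr0 // => l lj; rewrite mxE (negPf lj) mulr0.
Qed.

Lemma hcomp1l P Q (f : hom k P Q) : idm k Q ** f = f.
Proof.
apply/matrixP => i j; rewrite mxE (bigD1 i) //= mxE eqxx mulr1 wind_xyy mul1r.
by rewrite big1 ?addr0 // => l lj; rewrite mxE eq_sym (negPf lj) mulr0 mul0r.
Qed.

Lemma hcompDl P Q S (g g' : hom k Q S) (f : hom k P Q) :
  (g + g' : hom k Q S) ** f = g ** f + g' ** f.
Proof.
apply/matrixP => i j; rewrite !mxE -big_split; apply: eq_bigr => l _.
by rewrite mxE mulrDr mulrDl.
Qed.

Lemma hcompDr P Q S (g : hom k Q S) (f f' : hom k P Q) :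
  g ** (f + f' : hom k P Q) = g ** f + g ** f'.
Proof.
apply/matrixP => i j; rewrite !mxE -big_split; apply: eq_bigr => l _.
by rewrite mxE mulrDr.
Qed.

Lemma hcompZl P Q S a (g : hom k Q S) (f : hom k P Q) :
  (a *: g : hom k Q S) ** f = a *: (g ** f).
Proof.
apply/matrixP => i j; rewrite !mxE big_distrr; apply: eq_bigr => l _ /=.
by rewrite mxE; ring.
Qed.

Lemma hcompZr P Q S a (g : hom k Q S) (f : hom k P Q) :
  g ** (a *: f : hom k P Q) = a *: (g ** f).
Proof.
apply/matrixP => i j; rewrite !mxE big_distrr; apply: eq_bigr => l _ /=.
by rewrite mxE; ring.
Qed.

Lemma hcompNl P Q S (g : hom k Q S) (f : hom k P Q) :
  (- g : hom k Q S) ** f = - (g ** f).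
Proof. by rewrite -scaleN1r hcompZl scaleN1r. Qed.

Lemma hcompNr P Q S (g : hom k Q S) (f : hom k P Q) :
  g ** (- f : hom k P Q) = - (g ** f).
Proof. by rewrite -scaleN1r hcompZr scaleN1r. Qed.

Lemma hcompBl P Q S (g g' : hom k Q S) (f : hom k P Q) :
  (g - g' : hom k Q S) ** f = g ** f - g' ** f.
Proof. by rewrite hcompDl hcompNl. Qed.

Lemma hcompBr P Q S (g : hom k Q S) (f f' : hom k P Q) :
  g ** (f - f' : hom k P Q) = g ** f - g ** f'.
Proof. by rewrite hcompDr hcompNr. Qed.

Lemma hcomp0l P Q S (f : hom k P Q) : (0 : hom k Q S) ** f = 0.
Proof. by rewrite -(scale0r (0 : hom k Q S)) hcompZl scale0r. Qed.

Lemma hcomp0r P Q S (g : hom k Q S) : g ** (0 : hom k P Q) = 0.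
Proof. by rewrite -(scale0r (0 : hom k P Q)) hcompZr scale0r. Qed.

Lemma hcomp_row_col P Q S V (a : hom k P V) (b : hom k Q V)
    (c : hom k S P) (d : hom k S Q) :
  (row_mx a b : hom k (add_sum P Q) V) ** (col_mx c d : hom k S (add_sum P Q)) =
  a ** c + b ** d.
Proof.
apply/matrixP => i j; rewrite mxE /= big_split_ord /= [RHS]mxE !mxE.
by congr (_ + _); apply: eq_bigr => l _;
  rewrite ?split_lshift ?split_rshift ?row_mxEl ?row_mxEr ?col_mxEu ?col_mxEd.
Qed.

Lemma hcomp_col P Q S V (a : hom k P Q) (b : hom k P S) (f : hom k V P) :
  (col_mx a b : hom k P (add_sum Q S)) ** f =
  (col_mx (a ** f) (b ** f) : hom k V (add_sum Q S)).
Proof.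
apply/matrixP => i j; rewrite mxE /= -[i]splitK.
case: (fintype.split i) => i' /=; rewrite ?col_mxEu ?col_mxEd mxE;
  apply: eq_bigr => l _;
  by rewrite ?split_lshift ?split_rshift ?col_mxEu ?col_mxEd.
Qed.

Lemma hcomp_row P Q S V (a : hom k P S) (b : hom k Q S) (f : hom k S V) :
  f ** (row_mx a b : hom k (add_sum P Q) S) =
  (row_mx (f ** a) (f ** b) : hom k (add_sum P Q) V).
Proof.
apply/matrixP => i j; rewrite mxE /= -[j]splitK.
case: (fintype.split j) => i' /=; rewrite ?row_mxEl ?row_mxEr mxE;
  apply: eq_bigr => l _;
  by rewrite ?split_lshift ?split_rshift ?row_mxEl ?row_mxEr.
Qed.

Section Biproduct.
Variables P Q : addRZ Z.

Definition injl : hom k P (add_sum P Q) := col_mx 1%:M 0.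
Definition injr : hom k Q (add_sum P Q) := col_mx 0 1%:M.
Definition prl : hom k (add_sum P Q) P := row_mx 1%:M 0.
Definition prr : hom k (add_sum P Q) Q := row_mx 0 1%:M.

Lemma prl_injl : prl ** injl = idm k P.
Proof. by rewrite hcomp_row_col hcomp0l addr0 (@hcomp1 _ _ (idm k P)). Qed.
Lemma prl_injr : prl ** injr = 0.
Proof. by rewrite hcomp_row_col hcomp0l hcomp0r addr0. Qed.
Lemma prr_injl : prr ** injl = 0.
Proof. by rewrite hcomp_row_col hcomp0l hcomp0r addr0. Qed.
Lemma prr_injr : prr ** injr = idm k Q.
Proof. by rewrite hcomp_row_col hcomp0l add0r (@hcomp1 _ _ (idm k Q)). Qed.

(** Block matrices become sums of words in the injections and projections, so that later identities
    follow by rewriting words instead of comparing entries. *)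
Lemma inj_pr (f : hom k P P) (g : hom k P Q) (h : hom k Q P) (l : hom k Q Q) :
  injl ** f ** prl + injl ** h ** prr + injr ** g ** prl + injr ** l ** prr =
  (block_mx f h g l : hom k (add_sum P Q) (add_sum P Q)).
Proof.
rewrite /injl /injr /prl /prr !hcomp_col !hcomp_row.
rewrite -/(idm k P) -/(idm k Q) !(hcomp1l, hcomp0l, hcomp0r, hcomp1).
by rewrite !add_col_mx !add_row_mx !addr0 !add0r.
Qed.

Lemma inj_pr_id : injl ** prl + injr ** prr = idm k (add_sum P Q).
Proof.
have := inj_pr (idm k P) 0 0 (idm k Q).
rewrite !hcomp1 !hcomp0r !hcomp0l !addr0 => ->.
by rewrite -[RHS]/(1%:M) scalar_mx_block.
Qed.

End Biproduct.
End Additive.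

Section Rewriting.
Variables (R : realType) (Z : set (circle R)) (k : comNzRingType).
Implicit Types P Q S V : addRZ Z.

Definition hcompE := (@hcompDl R Z k, @hcompDr R Z k, @hcompNl R Z k, @hcompNr R Z k,
  @hcompZl R Z k, @hcompZr R Z k, @hcomp0l R Z k, @hcomp0r R Z k,
  @hcomp1 R Z k, @hcomp1l R Z k, @hcompA R Z k).

(** Words are kept left-associated; this form rewrites a product at the end of a longer word. *)
Lemma under_hcomp P Q S V (g : hom k Q S) (f : hom k P Q) (h : hom k P S) :
  g ** f = h -> forall x : hom k S V, x ** g ** f = x ** h.
Proof. by move=> <- x; rewrite hcompA. Qed.

Lemma mx_addE m n (A B : 'M[fps k]_(m, n)) i j : (A + B) i j = A i j + B i j.
Proof. by rewrite mxE. Qed.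
Lemma mx_oppE m n (A : 'M[fps k]_(m, n)) i j : (- A) i j = - A i j.
Proof. by rewrite mxE. Qed.
Lemma mx_scaleE m n a (A : 'M[fps k]_(m, n)) i j : (a *: A) i j = a * A i j.
Proof. by rewrite mxE. Qed.
Lemma mx_zeroE m n i j : (0 : 'M[fps k]_(m, n)) i j = 0.
Proof. by rewrite mxE. Qed.
Definition mx_linE := (mx_addE, mx_oppE, mx_scaleE, mx_zeroE).

Lemma prl_injlE P Q S (x : hom k P S) : x ** prl k P Q ** injl k P Q = x.
Proof. by rewrite (under_hcomp (prl_injl _ _ _)) hcomp1. Qed.
Lemma prl_injrE P Q S (x : hom k P S) : x ** prl k P Q ** injr k P Q = 0.
Proof. by rewrite (under_hcomp (prl_injr _ _ _)) hcomp0r. Qed.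
Lemma prr_injlE P Q S (x : hom k Q S) : x ** prr k P Q ** injl k P Q = 0.
Proof. by rewrite (under_hcomp (prr_injl _ _ _)) hcomp0r. Qed.
Lemma prr_injrE P Q S (x : hom k Q S) : x ** prr k P Q ** injr k P Q = x.
Proof. by rewrite (under_hcomp (prr_injr _ _ _)) hcomp1. Qed.

Definition biprodE := (prl_injlE, prl_injrE, prr_injlE, prr_injrE,
  @prl_injl R Z k, @prl_injr R Z k, @prr_injl R Z k, @prr_injr R Z k).

End Rewriting.

(** Rectangular matrices form no ring, so additive identities are passed to [ring] entrywise. *)
Ltac mx_abel := let i := fresh "i" in let j := fresh "j" in
  apply/matrixP => i j; rewrite !mx_linE; ring.

(** * Matrix factorisations *)

Section FrobeniusCategory.
Variables (R : realType) (Z : set (circle R)) (k : comNzRingType).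
Implicit Types P Q S V : addRZ Z.
Local Notation t := (fps_t k).

Hypothesis succZ_neq : forall z : Z, succZ z <> z.

Lemma wind_succ_last (z w : Z) : z <> succZ w -> wind z w (succZ w) = 0%N.
Proof.
move=> zw; have [->|ne] := pselect (z = w); first exact: wind_xx.
have := wind_cocycle z w (succZ w) z.
rewrite wind_succ; last by move=> e; exact: ne.
by rewrite !wind_xyx //; lia.
Qed.

Lemma wind_to_pred (z w : Z) : z <> succZ w -> wind z (succZ w) w = 1%N.
Proof.
move=> zw; have := wind_cocycle z w (succZ w) w.
rewrite wind_succ_last // wind_xyy wind_xyx //.
by move=> /esym; exact: succZ_neq.
Qed.

Lemma wind_from_succ (z w : Z) : w <> z -> wind (succZ z) z w = 1%N.
Proof.
move=> wz; have := wind_cocycle z (succZ z) z w.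
rewrite wind_xyx ?wind_xx ?wind_succ //.
- by move=> e; apply: wz.
- by move=> e; apply: (@succZ_neq z).
Qed.

(* The morphisms factoring through [eta_mor]: those in the radical of add RZ. *)
Definition Rad P Q (f : hom k P Q) := forall i j, vtx i = vtx j -> dvdt (f i j).

(* The morphisms factoring through the components f_{z z^+}. *)
Definition Corad P Q (f : hom k P Q) :=
  forall i j, vtx j <> succZ (vtx i) -> dvdt (f i j).

Lemma comp_eta P Q (f : hom k (phi P) Q) i (j : 'I_(rk P)) :
  (f ** eta_mor k P) i j = t ^+ wind (vtx j) (succZ (vtx j)) (vtx i) * f i j.
Proof.
rewrite mxE (bigD1 j) //= mxE eqxx mulr1 big1 ?addr0 // => l li.
by rewrite mxE (negPf li) mulr0.
Qed.

Lemma eta_comp P Q (f : hom k Q P) (i : 'I_(rk P)) j :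
  (eta_mor k P ** f) i j = t ^+ wind (vtx j) (vtx i) (succZ (vtx i)) * f i j.
Proof.
rewrite [LHS]mxE (bigD1 i) //= {1}/eta_mor mxE eqxx mulr1 big1 ?addr0 // => l li.
by rewrite mxE eq_sym (negPf li) mulr0 mul0r.
Qed.

(** Precomposition with eta multiplies an entry by t exactly when its source and target coincide:
    only a return to z by way of z^+ makes a full turn. *)
Lemma RadP P Q (f : hom k P Q) :
  Rad f <-> exists f' : hom k (phi P) Q, f = f' ** eta_mor k P.
Proof.
split=> [rf|[f' ->] i j ij]; last first.
  rewrite comp_eta ij wind_xyx; last by move=> /esym; exact: succZ_neq.
  by apply: dvdtMl; exact: dvdtt.
have /choice[g hg] : forall ij : 'I_(rk Q) * 'I_(rk P), exists y,
    f ij.1 ij.2 = t ^+ wind (vtx ij.2) (succZ (vtx ij.2)) (vtx ij.1) * y.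
  move=> [i j] /=; have [e|ne] := pselect (vtx i = vtx j).
    rewrite e wind_xyx; last by move=> /esym; exact: succZ_neq.
    exact: rf.
  by exists (f i j); rewrite wind_succ ?mul1r // => e; apply: ne.
exists (\matrix_(i, j) g (i, j)); apply/matrixP => i j.
by rewrite comp_eta mxE (hg (i, j)).
Qed.

Lemma Rad_left P Q (f : hom k P Q) :
  Rad (f : hom k P (phi Q)) ->
  exists f' : hom k P Q, f = eta_mor k Q ** f'.
Proof.
move=> rf.
have /choice[g hg] : forall ij : 'I_(rk Q) * 'I_(rk P), exists y,
    f ij.1 ij.2 = t ^+ wind (vtx ij.2) (vtx ij.1) (succZ (vtx ij.1)) * y.
  move=> [i j] /=; have [e|ne] := pselect (vtx j = succZ (vtx i)).
    rewrite e wind_xyx; last exact: succZ_neq.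
    by apply: rf.
  by exists (f i j); rewrite wind_succ_last ?mul1r.
exists (\matrix_(i, j) g (i, j)); apply/matrixP => i j.
by rewrite eta_comp mxE (hg (i, j)).
Qed.

Lemma dvdt_term n x : n = 1%N -> dvdt (t ^+ n * x).
Proof. by move=> ->; apply: dvdtMl; exact: dvdtt. Qed.

Lemma RadD P Q (f g : hom k P Q) : Rad f -> Rad g -> Rad (f + g : hom k P Q).
Proof. by move=> hf hg i j e; rewrite mxE; apply: dvdtD; [exact: hf|exact: hg]. Qed.

(** A path that returns to its start through another vertex makes a full turn and so acquires a
    factor t. *)
Lemma Rad_comp_l P Q S (g : hom k Q S) (f : hom k P Q) : Rad f -> Rad (g ** f).
Proof.
move=> hf i j ij; rewrite mxE; apply: dvdt_sum => l.
have [e|ne] := pselect (vtx l = vtx j); first by apply: dvdtMr; exact: hf.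
by rewrite -mulrA ij; apply: dvdt_term; apply: wind_xyx => e; apply: ne.
Qed.

Lemma Rad_comp_r P Q S (g : hom k Q S) (f : hom k P Q) : Rad g -> Rad (g ** f).
Proof.
move=> hg i j ij; rewrite mxE; apply: dvdt_sum => l.
have [e|ne] := pselect (vtx l = vtx j).
  by apply: dvdtMl; apply: dvdtMr; apply: hg; rewrite e.
by rewrite -mulrA ij; apply: dvdt_term; apply: wind_xyx => e; apply: ne.
Qed.

(** The move from z^+ to z is a full turn but for one step, so a path that enters z^+ from a
    different vertex and then moves to z completes a turn. *)
Lemma Corad_comp_r P Q S (g : hom k Q S) (f : hom k P Q) : Corad g -> Corad (g ** f).
Proof.
move=> hg i j ij; rewrite mxE; apply: dvdt_sum => l.
have [e|ne] := pselect (vtx l = succZ (vtx i)).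
  by rewrite -mulrA e; apply: dvdt_term; exact: wind_to_pred.
by apply: dvdtMl; apply: dvdtMr; exact: hg.
Qed.

Lemma Corad_comp_l P Q S (g : hom k Q S) (f : hom k P Q) : Corad f -> Corad (g ** f).
Proof.
move=> hf i j ij; rewrite mxE; apply: dvdt_sum => l.
have [e|ne] := pselect (vtx j = succZ (vtx l)); last by apply: dvdtMr; exact: hf.
rewrite -mulrA e; apply: dvdt_term; apply: wind_from_succ => il.
by apply: ij; rewrite il.
Qed.

(** This makes the product of a homotopy G with a cocycle divisible by t, so that the homotopy G / t
    acts on cocycles without denominators. *)
Lemma Corad_Rad P Q S (g : hom k Q S) (f : hom k P Q) : Corad g -> Rad f ->
  exists h : hom k P S, g ** f = t *: h.
Proof.
move=> hg hf; apply: mx_dvdt => i j; rewrite mxE; apply: dvdt_sum => l.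
have [e|ne] := pselect (vtx l = succZ (vtx i)); last first.
  by apply: dvdtMl; apply: dvdtMr; exact: hg.
have [e'|ne'] := pselect (vtx l = vtx j); first by apply: dvdtMr; exact: hf.
rewrite -mulrA e; apply: dvdt_term; apply: wind_to_pred => e2.
by apply: ne'; rewrite e e2.
Qed.

Lemma Rad_Corad P Q S (g : hom k Q S) (f : hom k P Q) : Rad g -> Corad f ->
  exists h : hom k P S, g ** f = t *: h.
Proof.
move=> hg hf; apply: mx_dvdt => i j; rewrite mxE; apply: dvdt_sum => l.
have [e|ne] := pselect (vtx j = succZ (vtx l)); last by apply: dvdtMr; exact: hf.
have [e'|ne'] := pselect (vtx i = vtx l).
  by apply: dvdtMl; apply: dvdtMr; exact: hg.
by rewrite -mulrA e; apply: dvdt_term; exact: wind_from_succ.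
Qed.

Lemma CoradD P Q (f g : hom k P Q) : Corad f -> Corad g -> Corad (f + g : hom k P Q).
Proof. by move=> hf hg i j e; rewrite mxE; apply: dvdtD; [exact: hf|exact: hg]. Qed.

(** The components are the f_{z z^+}; this is t times the inverse of eta. *)
Definition eps P : hom k (phi P) P := (1%:M : 'M[fps k]_(rk P)).

Lemma eps_comp P Q (f : hom k Q (phi P)) (i : 'I_(rk P)) j :
  (eps P ** f) i j = t ^+ wind (vtx j) (succZ (vtx i)) (vtx i) * f i j.
Proof.
rewrite mxE (bigD1 i) //= mxE eqxx mulr1 big1 ?addr0 // => l li.
by rewrite mxE eq_sym (negPf li) mulr0 mul0r.
Qed.

Lemma Corad_eps P : Corad (eps P).
Proof.
move=> i j; rewrite /= mxE; case: eqVneq => [<-|_ _] //; exact: dvdt0.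
Qed.

Lemma Rad_eta P : Rad (eta_mor k P).
Proof.
by apply/RadP; exists (idm k (phi P)); rewrite hcomp1l.
Qed.

Lemma eta_eps P : eta_mor k P ** eps P = t *: idm k (phi P).
Proof.
apply/matrixP => i j; rewrite eta_comp /eps !mxE /=.
case: eqVneq => [->|_]; last by rewrite !mulr0.
by rewrite wind_xyx.
Qed.

Lemma eps_eta P : eps P ** eta_mor k P = t *: idm k P.
Proof.
apply/matrixP => i j; rewrite eps_comp /eta_mor !mxE /=.
case: eqVneq => [->|_]; last by rewrite !mulr0.
by rewrite wind_xyx //; move=> /esym; exact: succZ_neq.
Qed.

Lemma eta_cancel_l P Q (f g : hom k Q P) :
  eta_mor k P ** f = eta_mor k P ** g -> f = g.
Proof.
move=> e; apply: (@scalet_cancel k).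
by have := congr1 (fun x => eps P ** x) e; rewrite !hcompA eps_eta !hcompZl !hcomp1l.
Qed.

Lemma eta_cancel_r P Q (f g : hom k (phi P) Q) :
  f ** eta_mor k P = g ** eta_mor k P -> f = g.
Proof.
move=> e; apply: (@scalet_cancel k).
have := congr1 (fun x => x ** eps P) e.
by rewrite -!hcompA eta_eps !hcompZr !hcomp1.
Qed.

Hypothesis succZ_surj : forall z : Z, exists w, succZ w = z.
Local Notation MF := (MF Z k).
Implicit Types X Y A B C W I E : MF.

Lemma mf_rad X : Rad (mf_d X).
Proof. by apply/RadP; exact: mf_factor. Qed.

Lemma mfE X Y (f : hom k X Y) : mf_mor f -> f ** mf_d X = mf_d Y ** f.
Proof. by []. Qed.

Lemma mfP X Y (f : hom k X Y) : f ** mf_d X = mf_d Y ** f -> mf_mor f.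
Proof. by []. Qed.

Lemma mf_mor_comp X Y W (g : hom k Y W) (f : hom k X Y) :
  mf_mor g -> mf_mor f -> mf_mor (g ** f).
Proof. by move=> hg hf; rewrite /mf_mor/= -hcompA (mfE hf) hcompA (mfE hg) hcompA. Qed.

Lemma mf_morD X Y (f g : hom k X Y) : mf_mor f -> mf_mor g -> mf_mor (f + g : hom k X Y).
Proof. by move=> hf hg; rewrite /mf_mor/= !hcompE (mfE hf) (mfE hg). Qed.

Lemma mf_morN X Y (f : hom k X Y) : mf_mor f -> mf_mor (- f : hom k X Y).
Proof. by move=> hf; rewrite /mf_mor/= !hcompE (mfE hf). Qed.

Lemma mf_mor1 X : mf_mor (idm k X).
Proof. by rewrite /mf_mor/= hcomp1 hcomp1l. Qed.

Lemma mf_mor0 X Y : mf_mor (0 : hom k X Y).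
Proof. by rewrite /mf_mor/= !hcompE. Qed.

(** * Extensions and null-homotopies *)

Definition cocyc X Y (u : hom k X Y) := Rad u /\ mf_d Y ** u + u ** mf_d X = 0.

Definition cobound X Y (u : hom k X Y) :=
  exists h : hom k X Y, u = h ** mf_d X - mf_d Y ** h.

(* Ext^1(X, Y) = 0: an extension of X by Y splits over add RZ, so its differential is
   [[d_Y, u], [0, d_X]] with u a cocycle, and it splits when u is a coboundary. *)
Definition ext0 X Y := forall u : hom k X Y, cocyc u -> cobound u.

(* f is null-homotopic, with homotopy G / t. Working with G avoids inverting eta: the
   elements of Corad are the t eta^-1 h. *)
Definition null X Y (f : hom k X Y) := exists G : hom k X Y,
  Corad G /\ t *: f = G ** mf_d X + mf_d Y ** G.

Lemma null_comp_r A X Y (f : hom k X Y) (g : hom k A X) :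
  null f -> mf_mor g -> null (f ** g).
Proof.
move=> [G [cG eG]] hg; exists (G ** g); split; first exact: Corad_comp_r.
by rewrite -hcompZl eG !hcompE (under_hcomp (mfE hg)) hcompA.
Qed.

Lemma null_comp_l A X Y (f : hom k X Y) (g : hom k Y A) :
  null f -> mf_mor g -> null (g ** f).
Proof.
move=> [G [cG eG]] hg; exists (g ** G); split; first exact: Corad_comp_l.
by rewrite -hcompZr eG !hcompE (mfE hg).
Qed.

Lemma nullD X Y (f g : hom k X Y) : null f -> null g -> null (f + g : hom k X Y).
Proof.
move=> [F [cF eF]] [G [cG eG]]; exists (F + G); split; first exact: CoradD.
by rewrite scalerDr eF eG !hcompE; mx_abel.
Qed.

Lemma cocycE X Y (u : hom k X Y) : cocyc u -> u ** mf_d X = - (mf_d Y ** u).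
Proof. by move=> [_ /eqP]; rewrite addr_eq0 => /eqP ->; rewrite opprK. Qed.

(** From t f = G d + d G and u d = - d u one gets t u f = (u G) d - d (u G), and u G is divisible by
    t. *)
Lemma cobound_null_r X Y A (u : hom k Y A) (f : hom k X Y) :
  cocyc u -> null f -> cobound (u ** f).
Proof.
move=> hu [G [cG eG]]; have [h eh] := Rad_Corad hu.1 cG.
exists h; apply: (@scalet_cancel k).
rewrite -hcompZr eG scalerBr -hcompZl -hcompZr -eh !hcompE.
by rewrite (cocycE hu) hcompNl.
Qed.

Lemma cobound_null_l X Y A (u : hom k A X) (f : hom k X Y) :
  cocyc u -> null f -> cobound (f ** u).
Proof.
move=> hu [G [cG eG]]; have [h eh] := Corad_Rad cG hu.1.
exists (- h); apply: (@scalet_cancel k).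
rewrite -hcompZl eG scalerBr -hcompZl -hcompZr scalerN -eh !hcompE.
by rewrite opprK -!hcompA (cocycE hu) !hcompE opprK addrC.
Qed.

Section Extension.
Variables (X Y : MF) (u : hom k X Y) (hu : cocyc u).

Definition ext_d : hom k (add_sum Y X) (add_sum Y X) :=
  injl k Y X ** mf_d Y ** prl k Y X + injl k Y X ** u ** prr k Y X +
  injr k Y X ** mf_d X ** prr k Y X.

Lemma ext_sqr : ext_d ** ext_d = t *: idm k (add_sum Y X).
Proof.
rewrite -inj_pr_id /ext_d !(hcompE, biprodE) (under_hcomp (mf_sqr Y)).
rewrite (under_hcomp (mf_sqr X)) !hcompE scalerDr.
have -> : injl k Y X ** u ** mf_d X ** prr k Y X = - (injl k Y X ** mf_d Y ** u ** prr k Y X).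
  by rewrite (under_hcomp (cocycE hu)) !hcompE.
by mx_abel.
Qed.

Lemma ext_factor : exists d' : hom k (phi (add_sum Y X)) (add_sum Y X),
  ext_d = d' ** eta_mor k (add_sum Y X).
Proof.
apply/RadP; apply: RadD; first apply: RadD;
  by apply: Rad_comp_r; apply: Rad_comp_l; [exact: mf_rad || exact: hu.1].
Qed.

Definition mf_ext : MF := MkMF ext_sqr ext_factor.

Lemma mf_ext_conflation :
  conflation (injl k Y X : hom k Y mf_ext) (prr k Y X : hom k mf_ext X).
Proof.
split.
- by rewrite /mf_mor/= /ext_d !(hcompE, biprodE) !addr0.
- by rewrite /mf_mor/= /ext_d !(hcompE, biprodE) !add0r.
exists (prl k Y X), (injr k Y X).
by split; rewrite ?inj_pr_id ?biprodE.
Qed.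

End Extension.

Section ConflationData.
Variables (A E W : MF) (i : hom k A E) (p : hom k E W).
Variables (r : hom k E A) (s : hom k W E).
Hypotheses (hi : mf_mor i) (hp : mf_mor p).
Hypotheses (ri : r ** i = idm k A) (ps : p ** s = idm k W) (pi : p ** i = 0)
  (irsp : i ** r + s ** p = idm k E).

Lemma conflation_rs : r ** s = 0.
Proof.
have := congr1 (fun f : hom k E E => r ** f ** s) irsp.
rewrite !hcompE ri !hcompE (under_hcomp ps) !hcompE => /eqP.
by rewrite -subr_eq0 addrK => /eqP.
Qed.

(** In the splitting of E by A and W the differential is triangular with corner r d s. The cocycle
    condition is the corner entry of d^2 = t. *)
Lemma conflation_cocyc : cocyc (r ** mf_d E ** s).
Proof.
split; first by apply: Rad_comp_r; apply: Rad_comp_l; exact: mf_rad.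
have e1 : r ** mf_d E ** i = mf_d A.
  by rewrite -hcompA -(mfE hi) hcompA ri hcomp1l.
have e2 : p ** mf_d E ** s = mf_d W by rewrite (mfE hp) -hcompA ps hcomp1.
transitivity (r ** mf_d E ** (i ** r + s ** p : hom k E E) ** mf_d E ** s).
  by rewrite -[in LHS]e1 -e2 !hcompE.
by rewrite irsp !hcompE (under_hcomp (mf_sqr E)) !hcompE conflation_rs scaler0.
Qed.

(* A lift of f along p has the form s f + i h, where h trivialises the
   pullback along f of the extension. *)
Lemma conflation_lift X (f : hom k X W) : mf_mor f ->
  cobound (r ** mf_d E ** s ** f) -> exists2 g : hom k X E, mf_mor g & p ** g = f.
Proof.
move=> hf [h eh]; exists (s ** f + i ** h); last first.
  by rewrite !hcompE ps pi !hcompE addr0.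
have ds : mf_d E ** s = s ** mf_d W + i ** r ** mf_d E ** s.
  rewrite -[LHS]hcomp1l -irsp !hcompE addrC; congr (_ + _).
  by rewrite (under_hcomp (mfE hp)) hcompA (under_hcomp ps) hcomp1.
have := congr1 (fun x => i ** x) eh; rewrite !hcompE => e.
rewrite /mf_mor/= !hcompE ds !hcompE e.
by rewrite (under_hcomp (mfE hf)) -(mfE hi) !hcompE; mx_abel.
Qed.

Lemma conflation_extend X (f : hom k A X) : mf_mor f ->
  cobound (f ** (r ** mf_d E ** s)) -> exists2 g : hom k E X, mf_mor g & g ** i = f.
Proof.
move=> hf [h eh]; exists (f ** r - h ** p); last first.
  by rewrite !hcompE (under_hcomp ri) (under_hcomp pi) !hcompE oppr0 addr0.
have dr : r ** mf_d E = mf_d A ** r + r ** mf_d E ** s ** p.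
  rewrite -[LHS]hcomp1 -irsp !hcompE; congr (_ + _).
  by rewrite -(hcompA r) -(mfE hi) !hcompE ri hcomp1l.
have := congr1 (fun x => x ** p) eh; rewrite !hcompE => e.
rewrite /mf_mor/= !hcompE -(hcompA f) dr !hcompE e.
by rewrite (mfE hf) (under_hcomp (mfE hp)) !hcompE; mx_abel.
Qed.

End ConflationData.

Lemma ext0_lift X A E W (i : hom k A E) (p : hom k E W) (f : hom k X W) :
  ext0 X A -> conflation i p -> mf_mor f ->
  exists2 g : hom k X E, mf_mor g & p ** g = f.
Proof.
move=> hX [hi hp [r [s [ri ps pi irsp]]]] hf.
apply: (conflation_lift hi hp ps pi irsp hf); apply: hX; split.
  by apply: Rad_comp_r; case: (conflation_cocyc hi hp ri ps irsp).
have [_ e] := conflation_cocyc hi hp ri ps irsp.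
by rewrite (under_hcomp (mfE hf)) !hcompA -hcompDl; move: e; rewrite !hcompA => ->; rewrite hcomp0l.
Qed.

Lemma ext0_extend X A E W (i : hom k A E) (p : hom k E W) (f : hom k A X) :
  ext0 W X -> conflation i p -> mf_mor f ->
  exists2 g : hom k E X, mf_mor g & g ** i = f.
Proof.
move=> hX [hi hp [r [s [ri ps pi irsp]]]] hf.
apply: (conflation_extend hi hp ri pi irsp hf); apply: hX; split.
  by apply: Rad_comp_l; case: (conflation_cocyc hi hp ri ps irsp).
have [_ e] := conflation_cocyc hi hp ri ps irsp.
by rewrite !hcompA -(mfE hf) -!(hcompA f) -hcompDr; move: e; rewrite !hcompA => ->; rewrite hcomp0r.
Qed.

Lemma null_ext0_l X Y : null (idm k X) -> ext0 X Y.
Proof. by move=> nX u hu; rewrite -[u]hcomp1; exact: cobound_null_r. Qed.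

Lemma null_ext0_r X Y : null (idm k Y) -> ext0 X Y.
Proof. by move=> nY u hu; rewrite -[u]hcomp1l; exact: cobound_null_l. Qed.

Lemma null_projective X : null (idm k X) -> mf_projective X.
Proof. by move=> nX A B C i p ip f hf; apply: (ext0_lift _ ip hf); exact: null_ext0_l. Qed.

Lemma null_injective X : null (idm k X) -> mf_injective X.
Proof. by move=> nX A B C i p ip f hf; apply: (ext0_extend _ ip hf); exact: null_ext0_r. Qed.

(* When d ** eta ** d = eps, the extension of (Q, - d eta) by (phi Q, eta d) given by eta is
   projective-injective, and every object is both of the form (phi Q, eta d) and (Q, - d eta). *)
Section Hull.
Variables (Q : addRZ Z) (d : hom k (phi Q) Q).
Hypothesis hd : d ** eta_mor k Q ** d = eps Q.

Lemma hull_sub_sqr : (eta_mor k Q ** d) ** (eta_mor k Q ** d) = t *: idm k (phi Q).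
Proof. by rewrite !hcompA -!(hcompA (eta_mor k Q)) hd eta_eps. Qed.

Lemma hull_sub_factor : exists d' : hom k (phi (phi Q)) (phi Q),
  eta_mor k Q ** d = d' ** eta_mor k (phi Q).
Proof. by apply/RadP; apply: Rad_comp_r; exact: Rad_eta. Qed.

Definition hull_sub : MF := MkMF hull_sub_sqr hull_sub_factor.

Lemma hull_quo_sqr : (- (d ** eta_mor k Q) : hom k Q Q) ** (- (d ** eta_mor k Q) : hom k Q Q)
  = t *: idm k Q.
Proof. by rewrite !hcompE opprK hd eps_eta. Qed.

Lemma hull_quo_factor : exists d' : hom k (phi Q) Q,
  - (d ** eta_mor k Q) = d' ** eta_mor k Q.
Proof. by exists (- d); rewrite !hcompE. Qed.

Definition hull_quo : MF := MkMF hull_quo_sqr hull_quo_factor.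

Lemma hull_cocyc : @cocyc hull_quo hull_sub (eta_mor k Q).
Proof. by split; [exact: Rad_eta | rewrite /= !hcompE subrr]. Qed.

Definition hull : MF := mf_ext hull_cocyc.

Lemma hull_null : null (idm k hull).
Proof.
(* The differential of the hull has eta in one corner; [eps] in the opposite corner inverts it up to
   t, and the two terms containing d cancel. *)
exists (injr k (phi Q) Q ** eps Q ** prl k (phi Q) Q); split.
  by apply: Corad_comp_r; apply: Corad_comp_l; exact: Corad_eps.
rewrite -[X in _ *: X]inj_pr_id /= /ext_d /= !(hcompE, biprodE).
rewrite !(under_hcomp (eta_eps _)) !(under_hcomp (eps_eta _)) !hcompE.
by mx_abel.
Qed.

End Hull.

Lemma phi_surj P : exists Q, P = phi Q.
Proof.
case: P => n v; have /choice[g hg] : forall i, exists w, succZ w = v i by move=> i.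
by exists (AddRZ g); rewrite /phi /=; congr AddRZ; apply/funext => i; rewrite hg.
Qed.

Lemma MkMF_congr P (d d' : hom k P P) e e' h h' :
  d = d' -> @MkMF R Z k P d e h = @MkMF R Z k P d' e' h'.
Proof. by move=> dd; subst d'; congr MkMF; exact: Prop_irrelevance. Qed.

Lemma hull_quoP I : exists (Q : addRZ Z) (d : hom k (phi Q) Q)
  (hd : d ** eta_mor k Q ** d = eps Q), I = hull_quo hd.
Proof.
case: I => Q d sq fac; have [d' ed] := fac.
have hd : (- d' : hom k (phi Q) Q) ** eta_mor k Q ** (- d' : hom k (phi Q) Q) = eps Q.
  apply: eta_cancel_r; rewrite !hcompE opprK eps_eta -sq ed.
  by rewrite !hcompE.
exists Q, (- d'), hd.
by apply: MkMF_congr; rewrite hcompNl opprK.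
Qed.

Lemma hull_subP I : exists (Q : addRZ Z) (d : hom k (phi Q) Q)
  (hd : d ** eta_mor k Q ** d = eps Q), I = hull_sub hd.
Proof.
case: I => P d sq fac; have [Q eQ] := phi_surj P; subst P.
have [d' ed] : exists d' : hom k (phi Q) Q, d = eta_mor k Q ** d'.
  by apply: Rad_left; apply/RadP.
have hd : d' ** eta_mor k Q ** d' = eps Q.
  by apply: eta_cancel_l; rewrite eta_eps -sq ed !hcompE.
by exists Q, d', hd; apply: MkMF_congr.
Qed.

(** A projective object is a retract of the hull mapping onto it, so its identity factors through a
    contractible object. *)
Lemma projective_null I : mf_projective I -> null (idm k I).
Proof.
have [Q [d [hd ->]]] := hull_quoP I => hI.
have [g hg e] := hI _ _ _ _ _ (mf_ext_conflation (hull_cocyc hd)) _ (mf_mor1 _).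
rewrite -e; apply: null_comp_l; last by case: (mf_ext_conflation (hull_cocyc hd)).
by rewrite -[g]hcomp1l; apply: null_comp_r => //; exact: hull_null.
Qed.

Lemma injective_null I : mf_injective I -> null (idm k I).
Proof.
have [Q [d [hd ->]]] := hull_subP I => hI.
have [g hg e] := hI _ _ _ _ _ (mf_ext_conflation (hull_cocyc hd)) _ (mf_mor1 _).
rewrite -e; apply: null_comp_r; last by case: (mf_ext_conflation (hull_cocyc hd)).
by rewrite -[g]hcomp1; apply: null_comp_l => //; exact: hull_null.
Qed.

Lemma suspension_exists X : exists S : suspension X, True.
Proof.
have [Q [d [hd ->]]] := hull_subP X.
by exists (Suspension (null_injective (hull_null hd)) (mf_ext_conflation (hull_cocyc hd))).
Qed.

Lemma stable_eq_null X Y (f g : hom k X Y) : stable_eq f g -> null (f - g : hom k X Y).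
Proof.
move=> [I [u [v [/projective_null nI hu hv ->]]]].
by rewrite -[v]hcomp1; apply: null_comp_r => //; exact: null_comp_l.
Qed.

(** Lets unification read [add_sum X Y], the end of an injection or projection, as the base of
    [mf_sum X Y]. *)
Canonical Defs.mf_sum.

Section Sums.
Variables X Y : MF.
Local Notation XY := (mf_sum X Y).

Lemma mf_sum_dE : mf_d XY =
  injl k X Y ** mf_d X ** prl k X Y + injr k X Y ** mf_d Y ** prr k X Y.
Proof.
rewrite /= /mf_sum_d -inj_pr !hcompE; mx_abel.
Qed.

Lemma mf_mor_injl : mf_mor (injl k X Y : hom k X XY).
Proof. by apply: mfP; rewrite mf_sum_dE !(hcompE, biprodE) addr0. Qed.
Lemma mf_mor_injr : mf_mor (injr k X Y : hom k Y XY).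
Proof. by apply: mfP; rewrite mf_sum_dE !(hcompE, biprodE) add0r. Qed.
Lemma mf_mor_prl : mf_mor (prl k X Y : hom k XY X).
Proof. by apply: mfP; rewrite mf_sum_dE !(hcompE, biprodE) addr0. Qed.
Lemma mf_mor_prr : mf_mor (prr k X Y : hom k XY Y).
Proof. by apply: mfP; rewrite mf_sum_dE !(hcompE, biprodE) add0r. Qed.

Lemma null_sum : null (idm k X) -> null (idm k Y) -> null (idm k XY).
Proof.
move=> nX nY; rewrite -[idm k _](inj_pr_id k X Y) -[injl k X Y]hcomp1 -[injr k X Y]hcomp1.
apply: nullD.
  by apply: null_comp_r mf_mor_prl; apply: null_comp_l mf_mor_injl.
by apply: null_comp_r mf_mor_prr; apply: null_comp_l mf_mor_injr.
Qed.

End Sums.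

Ltac mf_struct := repeat lazymatch goal with
  | |- mf_mor (hcomp _ _) => apply: mf_mor_comp
  | |- mf_mor (GRing.add _ _) => apply: mf_morD
  | |- mf_mor (GRing.opp _) => apply: mf_morN
  | |- mf_mor (injl _ _ _) => exact: mf_mor_injl
  | |- mf_mor (injr _ _ _) => exact: mf_mor_injr
  | |- mf_mor (prl _ _ _) => exact: mf_mor_prl
  | |- mf_mor (prr _ _ _) => exact: mf_mor_prr
  | |- mf_mor (idm _ _) => exact: mf_mor1
  | |- _ => assumption
  end.

(** * Stable isomorphism *)

Lemma projectiveP I : mf_projective I <-> null (idm k I).
Proof. by split; [exact: projective_null | exact: null_projective]. Qed.

Lemma stable_eq_refl X Y (f : hom k X Y) : stable_eq f f.
Proof.
exists (mf_zero Z k), 0, 0; rewrite subrr hcomp0l; split; [|exact: mf_mor0..|by []].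
apply/projectiveP; exists 0; split; first by move=> [].
by apply/matrixP => -[].
Qed.

Lemma stable_eqD X Y (f f' g g' : hom k X Y) : stable_eq f f' -> stable_eq g g' ->
  stable_eq (f + g : hom k X Y) (f' + g' : hom k X Y).
Proof.
move=> [I [u [v [pI hu hv e]]]] [J [u' [v' [pJ hu' hv' e']]]].
exists (mf_sum I J), (injl k I J ** u + injr k I J ** u'), (v ** prl k I J + v' ** prr k I J).
split.
- by apply/projectiveP; apply: null_sum; apply/projectiveP.
- by mf_struct.
- by mf_struct.
- by rewrite !(hcompE, biprodE) addr0 add0r -e -e'; mx_abel.
Qed.

Lemma stable_eq_comp_l X Y W (f f' : hom k X Y) (g : hom k Y W) : mf_mor g ->
  stable_eq f f' -> stable_eq (g ** f) (g ** f').
Proof.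
move=> hg [I [u [v [pI hu hv e]]]]; exists I, u, (g ** v); split=> //.
  exact: mf_mor_comp.
by rewrite -hcompBr e hcompA.
Qed.

Lemma stable_eq_comp_r X Y W (f f' : hom k X Y) (g : hom k W X) : mf_mor g ->
  stable_eq f f' -> stable_eq (f ** g) (f' ** g).
Proof.
move=> hg [I [u [v [pI hu hv e]]]]; exists I, (u ** g), v; split=> //.
  exact: mf_mor_comp.
by rewrite -hcompBl e hcompA.
Qed.

Lemma stable_eq_trans X Y (f g h : hom k X Y) :
  stable_eq f g -> stable_eq g h -> stable_eq f h.
Proof.
move=> fg gh; have := stable_eqD (stable_eqD fg gh) (stable_eq_refl (- g : hom k X Y)).
have -> : (f + g - g : hom k X Y) = f by mx_abel.
by have -> : (g + h - g : hom k X Y) = h by mx_abel.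
Qed.

Lemma stable_eq_sym X Y (f g : hom k X Y) : stable_eq f g -> stable_eq g f.
Proof.
move=> [I [u [v [pI hu hv e]]]]; exists I, u, (- v); split=> //; first exact: mf_morN.
by rewrite hcompNl -e opprB.
Qed.

Lemma stable_iso_comp X Y W (g : hom k Y W) (f : hom k X Y) :
  stable_iso g -> stable_iso f -> stable_iso (g ** f).
Proof.
move=> [hg [g' [hg' g'g gg']]] [hf [f' [hf' f'f ff']]]; split; first exact: mf_mor_comp.
exists (f' ** g'); split; first exact: mf_mor_comp.
- apply: stable_eq_trans f'f.
  have := stable_eq_comp_r hf (stable_eq_comp_l hf' g'g).
  by rewrite !hcompE.
- apply: stable_eq_trans gg'.
  have := stable_eq_comp_r hg' (stable_eq_comp_l hg ff').
  by rewrite !hcompE.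
Qed.

Lemma stable_iso_of_inverse X Y (f : hom k X Y) (g : hom k Y X) :
  mf_mor f -> mf_mor g -> g ** f = idm k X -> f ** g = idm k Y -> stable_iso f.
Proof.
by move=> hf hg gf fg; split=> //; exists g; rewrite gf fg; split=> //; exact: stable_eq_refl.
Qed.

Lemma stable_iso1 X : stable_iso (idm k X).
Proof.
by apply: (@stable_iso_of_inverse _ _ _ (idm k X)); rewrite ?hcomp1 //; exact: mf_mor1.
Qed.

Local Notation "X ~= Y" := (stably_isomorphic X Y) (at level 70).

Lemma siso_refl X : X ~= X.
Proof. by exists (idm k X); exact: stable_iso1. Qed.

Lemma siso_sym X Y : X ~= Y -> Y ~= X.
Proof. by move=> [f [hf [g [hg gf fg]]]]; exists g; split=> //; exists f. Qed.

Lemma siso_trans X Y W : X ~= Y -> Y ~= W -> X ~= W.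
Proof. by move=> [f hf] [g hg]; exists (g ** f); exact: stable_iso_comp. Qed.

Lemma siso_sum X X' Y Y' : X ~= X' -> Y ~= Y' -> mf_sum X Y ~= mf_sum X' Y'.
Proof.
move=> [f [hf [f' [hf' f'f ff']]]] [g [hg [g' [hg' g'g gg']]]].
pose sum A A' B B' (a : hom k A A') (b : hom k B B') : hom k (mf_sum A B) (mf_sum A' B') :=
  injl k A' B' ** a ** prl k A B + injr k A' B' ** b ** prr k A B.
have sum_mor A A' B B' (a : hom k A A') (b : hom k B B') :
    mf_mor a -> mf_mor b -> mf_mor (sum A A' B B' a b).
  by move=> ha hb; rewrite /sum; mf_struct.
have sum_id A A' B B' (a : hom k A A') (b : hom k B B') (a' : hom k A' A) (b' : hom k B' B) :
    stable_eq (a' ** a) (idm k A) -> stable_eq (b' ** b) (idm k B) ->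
    stable_eq (sum _ _ _ _ a' b' ** sum _ _ _ _ a b) (idm k (mf_sum A B)).
  move=> ea eb; rewrite -[idm k (mf_sum A B)](inj_pr_id k A B) /sum.
  rewrite !(hcompE, biprodE) !addr0 add0r; apply: stable_eqD.
    have := stable_eq_comp_r (mf_mor_prl A B) (stable_eq_comp_l (mf_mor_injl A B) ea).
    by rewrite !hcompE.
  have := stable_eq_comp_r (mf_mor_prr A B) (stable_eq_comp_l (mf_mor_injr A B) eb).
  by rewrite !hcompE.
exists (sum _ _ _ _ f g); split; first exact: sum_mor.
by exists (sum _ _ _ _ f' g'); split; [exact: sum_mor | exact: sum_id | exact: sum_id].
Qed.

Lemma siso_sumC X Y : mf_sum X Y ~= mf_sum Y X.
Proof.
pose s A B : hom k (mf_sum A B) (mf_sum B A) :=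
  injr k B A ** prl k A B + injl k B A ** prr k A B.
have s_mor A B : mf_mor (s A B).
  by rewrite /s; mf_struct.
have sK A B : s B A ** s A B = idm k (mf_sum A B).
  by rewrite -[idm k (mf_sum A B)](inj_pr_id k A B) /s !(hcompE, biprodE); mx_abel.
exists (s X Y); apply: stable_iso_of_inverse; [exact: s_mor|exact: s_mor|exact: sK|exact: sK].
Qed.

Lemma siso_sumA X Y W : mf_sum X (mf_sum Y W) ~= mf_sum (mf_sum X Y) W.
Proof.
pose f : hom k (mf_sum X (mf_sum Y W)) (mf_sum (mf_sum X Y) W) :=
  injl k (mf_sum X Y) W ** injl k X Y ** prl k X (mf_sum Y W) +
  injl k (mf_sum X Y) W ** injr k X Y ** prl k Y W ** prr k X (mf_sum Y W) +
  injr k (mf_sum X Y) W ** prr k Y W ** prr k X (mf_sum Y W).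
pose g : hom k (mf_sum (mf_sum X Y) W) (mf_sum X (mf_sum Y W)) :=
  injl k X (mf_sum Y W) ** prl k X Y ** prl k (mf_sum X Y) W +
  injr k X (mf_sum Y W) ** injl k Y W ** prr k X Y ** prl k (mf_sum X Y) W +
  injr k X (mf_sum Y W) ** injr k Y W ** prr k (mf_sum X Y) W.
exists f; apply: (@stable_iso_of_inverse _ _ _ g).
- by rewrite /f; mf_struct.
- by rewrite /g; mf_struct.
- rewrite -[RHS](inj_pr_id k X (mf_sum Y W)) -[in RHS](hcomp1 (injr k X (mf_sum Y W))).
  rewrite -(inj_pr_id k Y W) /g /f !(hcompE, biprodE); mx_abel.
- rewrite -[RHS](inj_pr_id k (mf_sum X Y) W) -[in RHS](hcomp1 (injl k (mf_sum X Y) W)).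
  rewrite -(inj_pr_id k X Y) /g /f !(hcompE, biprodE); mx_abel.
Qed.

Lemma cocyc_comp_r X X' Y (u : hom k X Y) (f : hom k X' X) :
  cocyc u -> mf_mor f -> cocyc (u ** f).
Proof.
move=> hu hf; split; first by apply: Rad_comp_r; case: hu.
by rewrite (under_hcomp (mfE hf)) !hcompA (cocycE hu) hcompNl subrr.
Qed.

Lemma cocyc_comp_l X Y Y' (u : hom k X Y) (f : hom k Y Y') :
  cocyc u -> mf_mor f -> cocyc (f ** u).
Proof.
move=> hu hf; split; first by apply: Rad_comp_l; case: hu.
by rewrite (under_hcomp (cocycE hu)) !hcompE (mfE hf) subrr.
Qed.

Lemma cobound_comp_r X X' Y (u : hom k X Y) (f : hom k X' X) :
  cobound u -> mf_mor f -> cobound (u ** f).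
Proof.
move=> [h ->] hf; exists (h ** f).
by rewrite !hcompE (under_hcomp (mfE hf)) !hcompA.
Qed.

Lemma cobound_comp_l X Y Y' (u : hom k X Y) (f : hom k Y Y') :
  cobound u -> mf_mor f -> cobound (f ** u).
Proof. by move=> [h ->] hf; exists (f ** h); rewrite !hcompE (mfE hf). Qed.

Lemma coboundD X Y (u v : hom k X Y) : cobound u -> cobound v -> cobound (u + v : hom k X Y).
Proof. by move=> [h ->] [g ->]; exists (h + g); rewrite !hcompE; mx_abel. Qed.

(** Ext^1 depends only on stable classes: u and u g f differ by a cocycle composed with a
    null-homotopic map, hence by a coboundary. *)
Lemma ext0_retract_l X X' Y (f : hom k X X') (g : hom k X' X) :
  mf_mor f -> mf_mor g -> stable_eq (g ** f) (idm k X) -> ext0 X' Y -> ext0 X Y.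
Proof.
move=> hf hg gf hX' u hu.
have -> : u = u ** g ** f - u ** (g ** f - idm k X : hom k X X).
  by rewrite !hcompE; mx_abel.
rewrite -hcompNr; apply: coboundD.
  by apply: cobound_comp_r => //; apply: hX'; exact: cocyc_comp_r.
apply: cobound_null_r => //; rewrite opprB; apply: stable_eq_null.
exact: stable_eq_sym.
Qed.

Lemma ext0_retract_r X Y Y' (f : hom k Y Y') (g : hom k Y' Y) :
  mf_mor f -> mf_mor g -> stable_eq (g ** f) (idm k Y) -> ext0 X Y' -> ext0 X Y.
Proof.
move=> hf hg gf hY' u hu.
have -> : u = g ** (f ** u) - (g ** f - idm k Y : hom k Y Y) ** u.
  by rewrite !hcompE; mx_abel.
rewrite -hcompNl; apply: coboundD.
  by apply: cobound_comp_l => //; apply: hY'; exact: cocyc_comp_l.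
apply: cobound_null_l => //; rewrite opprB; apply: stable_eq_null.
exact: stable_eq_sym.
Qed.

Lemma ext0_summand_l X X' W Y : mf_sum X X' ~= W -> ext0 W Y -> ext0 X Y.
Proof.
move=> [f [hf [g [hg gf _]]]].
apply: (@ext0_retract_l _ _ _ (f ** injl k X X') (prl k X X' ** g)); [mf_struct..|].
have := stable_eq_comp_r (mf_mor_injl X X') (stable_eq_comp_l (mf_mor_prl X X') gf).
by rewrite !hcompE prl_injl.
Qed.

Lemma ext0_summand_r X Y Y' W : mf_sum Y Y' ~= W -> ext0 X W -> ext0 X Y.
Proof.
move=> [f [hf [g [hg gf _]]]].
apply: (@ext0_retract_r _ _ _ (f ** injl k Y Y') (prl k Y Y' ** g)); [mf_struct..|].
have := stable_eq_comp_r (mf_mor_injl Y Y') (stable_eq_comp_l (mf_mor_prl Y Y') gf).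
by rewrite !hcompE prl_injl.
Qed.

Lemma ext0_siso_l X X' Y : X ~= X' -> ext0 X' Y -> ext0 X Y.
Proof. by move=> [f [hf [g [hg gf _]]]]; exact: (ext0_retract_l hf hg gf). Qed.

Lemma ext0_siso_r X Y Y' : Y ~= Y' -> ext0 X Y' -> ext0 X Y.
Proof. by move=> [f [hf [g [hg gf _]]]]; exact: (ext0_retract_r hf hg gf). Qed.

Lemma ext0_sum_l X X' Y : ext0 X Y -> ext0 X' Y -> ext0 (mf_sum X X') Y.
Proof.
move=> hX hX' u hu; rewrite -[u]hcomp1 -inj_pr_id !hcompE.
apply: coboundD; apply: cobound_comp_r; [|exact: mf_mor_prl| |exact: mf_mor_prr].
  by apply: hX; apply: (cocyc_comp_r hu); exact: mf_mor_injl.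
by apply: hX'; apply: (cocyc_comp_r hu); exact: mf_mor_injr.
Qed.

Lemma ext0_sum_r X Y Y' : ext0 X Y -> ext0 X Y' -> ext0 X (mf_sum Y Y').
Proof.
move=> hY hY' u hu; rewrite -[u]hcomp1l -inj_pr_id hcompDl -!hcompA.
apply: coboundD; apply: cobound_comp_l; [|exact: mf_mor_injl| |exact: mf_mor_injr].
  by apply: hY; apply: (cocyc_comp_l hu); exact: mf_mor_prl.
by apply: hY'; apply: (cocyc_comp_l hu); exact: mf_mor_prr.
Qed.

Lemma null_zero : null (idm k (mf_zero Z k)).
Proof.
exists 0; split; first by move=> [].
by apply/matrixP => -[].
Qed.

Section AddT.
Variable T : set (set Z).

Lemma ext0_addT X Y :
  (forall a b c d, T [set a; b] -> T [set c; d] -> ext0 (diag_obj k a b) (diag_obj k c d)) ->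
  addT T X -> addT T Y -> ext0 X Y.
Proof.
move=> hT [X' [l [hl iX]]] [Y' [m [hm iY]]].
apply: (ext0_summand_l iX); apply: (ext0_summand_r iY).
elim: l hl {iX} => [|[a b] l IH] hl; first exact: null_ext0_l null_zero.
apply: ext0_sum_l; last by apply: IH => ab hab; apply: hl; rewrite inE hab orbT.
have Tab : T [set a; b] by apply: (hl (a, b)); rewrite mem_head.
elim: m hm {iY IH} => [|[c d] m IHm] hm; first exact: null_ext0_r null_zero.
apply: ext0_sum_r; last by apply: IHm => cd hcd; apply: hm; rewrite inE hcd orbT.
by apply: hT Tab _; apply: (hm (c, d)); rewrite mem_head.
Qed.

Lemma siso_sumCA X X' Y Y' :
  mf_sum (mf_sum X X') (mf_sum Y Y') ~= mf_sum (mf_sum X Y) (mf_sum X' Y').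
Proof.
apply: siso_trans (siso_sym (siso_sumA _ _ _)) _.
apply: siso_trans _ (siso_sumA _ _ _); apply: siso_sum (siso_refl _) _.
apply: siso_trans (siso_sumA _ _ _) _.
apply: siso_trans _ (siso_sym (siso_sumA _ _ _)); apply: siso_sum _ (siso_refl _).
exact: siso_sumC.
Qed.

Lemma null_siso0 X : null (idm k X) -> X ~= mf_zero Z k.
Proof.
move=> nX; exists 0; split; first exact: mf_mor0.
exists 0; split; first exact: mf_mor0.
- rewrite hcomp0l; exists X, (- idm k X), (idm k X); rewrite hcomp1l sub0r; split=> //.
  + exact: null_projective.
  + exact: mf_morN (mf_mor1 _).
  + exact: mf_mor1.
- rewrite hcomp0l; have -> : idm k (mf_zero Z k) = 0 by apply/matrixP => -[].
  exact: stable_eq_refl.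
Qed.

Lemma siso_sum0 X : mf_sum X (mf_zero Z k) ~= X.
Proof.
exists (prl k X (mf_zero Z k)).
apply: (@stable_iso_of_inverse _ _ _ (injl k X (mf_zero Z k))).
- exact: mf_mor_prl.
- exact: mf_mor_injl.
- rewrite -[RHS](inj_pr_id k X (mf_zero Z k)).
  have -> : prr k X (mf_zero Z k) = 0 by apply/matrixP => -[].
  by rewrite hcomp0r addr0.
- exact: prl_injl.
Qed.

Lemma siso_sum0l X : mf_sum (mf_zero Z k) X ~= X.
Proof. exact: siso_trans (siso_sumC _ _) (siso_sum0 _). Qed.

Lemma diag_sum_cat l m : diag_sum k (l ++ m) ~= mf_sum (diag_sum k l) (@diag_sum R Z k m).
Proof.
elim: l => [|ab l IH] /=; first exact: siso_sym (siso_sum0l _).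
apply: siso_trans _ (siso_sumA _ _ _); exact: siso_sum (siso_refl _) IH.
Qed.

Lemma addT_sum X Y : addT T X -> addT T Y -> addT T (mf_sum X Y).
Proof.
move=> [X' [l [hl iX]]] [Y' [m [hm iY]]]; exists (mf_sum X' Y'), (l ++ m); split.
  by move=> ab; rewrite mem_cat => /orP[/hl|/hm].
apply: siso_trans (siso_sumCA _ _ _ _) _.
apply: siso_trans (siso_sum iX iY) _; exact: siso_sym (diag_sum_cat _ _).
Qed.

Lemma addT0 : addT T (mf_zero Z k).
Proof. by exists (mf_zero Z k), [::]; split=> //; exact: siso_sum0. Qed.

Lemma addT_diag a b : T [set a; b] -> addT T (diag_obj k a b).
Proof.
move=> Tab; exists (mf_zero Z k), [:: (a, b)]; split; last exact: siso_refl.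
by move=> ab; rewrite inE => /eqP ->.
Qed.

End AddT.

(** * Triangles, conflations and Schanuel's lemma *)

Lemma conflation_kernel A E W X (i : hom k A E) (p : hom k E W) (g : hom k X E) :
  conflation i p -> mf_mor g -> p ** g = 0 -> exists2 h : hom k X A, mf_mor h & i ** h = g.
Proof.
move=> [hi hp [r [s [ri ps pi irsp]]]] hg pg.
have ih : i ** (r ** g) = g.
  by rewrite -[RHS]hcomp1l -irsp hcompDl -(hcompA s) pg hcomp0r addr0 hcompA.
exists (r ** g) => //; apply: mfP; move: (r ** g) ih => h ih.
have : i ** (h ** mf_d X) = i ** (mf_d A ** h).
  by rewrite !hcompA ih (mfE hi) -hcompA ih (mfE hg).
by move=> /(congr1 (fun x => r ** x)); rewrite !hcompA ri !hcomp1l.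
Qed.

Lemma stable_iso_of_sides X Y (f : hom k X Y) (g h : hom k Y X) :
  mf_mor f -> mf_mor g -> mf_mor h ->
  stable_eq (g ** f) (idm k X) -> stable_eq (f ** h) (idm k Y) -> stable_iso f.
Proof.
move=> hf hg hh gf fh; split=> //; exists g; split=> //; apply: (stable_eq_trans _ fh).
have fgfh := stable_eq_comp_l hf (stable_eq_comp_r hh gf).
have fgfh' := stable_eq_comp_l hf (stable_eq_comp_l hg fh).
move: fgfh fgfh'; rewrite !hcompE => e1 e2.
exact: stable_eq_trans (stable_eq_sym e2) e1.
Qed.

Lemma stable_iso_injl X I : mf_projective I -> stable_iso (injl k X I : hom k X (mf_sum X I)).
Proof.
move=> pI; split; first exact: mf_mor_injl.
exists (prl k X I); split; first exact: mf_mor_prl.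
  by rewrite prl_injl; exact: stable_eq_refl.
exists I, (prr k X I), (- injr k X I); split=> //; [mf_struct..|].
by rewrite -[idm k (mf_sum X I)](inj_pr_id k X I) !hcompE; mx_abel.
Qed.

Lemma injective_projective I : mf_injective I -> mf_projective I.
Proof. by move=> /injective_null /null_projective. Qed.

(** The pushout square of a standard triangle gives a conflation from A to B + I to C; the hull I is
    also projective, so B + I is stably B. *)
Lemma distinguished_conflation X Y W (S : suspension X)
    (u : hom k X Y) (v : hom k Y W) (w : hom k W (susp_obj S)) : distinguished u v w ->
  exists (A B C : MF) (i : hom k A B) (p : hom k B C),
    [/\ conflation i p, X ~= A, Y ~= B & W ~= C].
Proof.
move=> [hu hv hw [A [B [C [SA [u' [v' [w' [a [b [c [s [std [ia ib ic _] _]]]]]]]]]]]]].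
have [hu' [hv' hw' [rv [sw [rv1 sw1 wv vrsw]]]] [h [hh hin hout]]] := std.
have [hi ho [ri [so [ri1 so1 oi irso]]]] := susp_conflation SA.
set I := susp_hull SA in h hh hin hout hi ho ri so ri1 so1 oi irso *.
set inn := susp_in SA in hin hi ri1 oi irso *.
set out := susp_out SA in hout ho so1 oi irso *.
exists A, (mf_sum B I), C, (injl k B I ** u' - injr k B I ** inn),
  (v' ** prl k B I + h ** prr k B I).
split; [|by exists a| |by exists c]; last first.
  apply: (@siso_trans _ B); first by exists b.
  exists (injl k B I); apply: stable_iso_injl.
  exact: injective_projective (susp_injective (s := SA)).
split; [by mf_struct | by mf_struct |].
(* The map id - h so w' takes values in the kernel of w', on which [rv] is inverse to v'; the
   remaining part h so w' lifts to I through [so]. *)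
exists (- (ri ** prr k B I)),
  (injl k B I ** rv ** (idm k C - h ** so ** w' : hom k C C) + injr k B I ** so ** w').
have e : v' ** rv = idm k C - sw ** w' by rewrite -vrsw; mx_abel.
have e' : so ** out = idm k I - inn ** ri by rewrite -irso; mx_abel.
split.
- by rewrite !(hcompE, biprodE) ri1; mx_abel.
- rewrite !(hcompE, biprodE) e !hcompE (under_hcomp hout) (under_hcomp so1) !hcompE; mx_abel.
- by rewrite !(hcompE, biprodE) hin; mx_abel.
- rewrite -[RHS](inj_pr_id k B I) !(hcompE, biprodE).
  rewrite !(under_hcomp hout) !(under_hcomp wv) !(under_hcomp e') !(under_hcomp rv1).
  rewrite !hcompE !(under_hcomp hin) !hcompE !(under_hcomp rv1) !hcompE.
  mx_abel.
Qed.

(* The comparison maps l, m between the middle terms exist because both conflations are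
   approximations; the two composites of the resulting maps between X1 + B2 and B1 + X2
   are triangular with stable identities on the diagonal. *)
Lemma stable_schanuel X1 B1 W1 X2 B2 W2
    (i1 : hom k X1 B1) (p1 : hom k B1 W1) (i2 : hom k X2 B2) (p2 : hom k B2 W2) :
  conflation i1 p1 -> conflation i2 p2 -> W1 ~= W2 -> ext0 B2 X1 -> ext0 B1 X2 ->
  mf_sum X1 B2 ~= mf_sum B1 X2.
Proof.
move=> c1 c2 [f [hf [f' [hf' f'f ff']]]] h21 h12.
have [hi1 hp1 [r1 [s1 [ri1 _ pi1 _]]]] := c1.
have [hi2 hp2 [r2 [s2 [ri2 _ pi2 _]]]] := c2.
have [l hl pl] : exists2 l : hom k B2 B1, mf_mor l & p1 ** l = f' ** p2.
  by apply: (ext0_lift h21 c1); exact: mf_mor_comp.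
have [m hm pm] : exists2 m : hom k B1 B2, mf_mor m & p2 ** m = f ** p1.
  by apply: (ext0_lift h12 c2); exact: mf_mor_comp.
have [J1 [u1 [v1 [pJ1 hu1 hv1 e1]]]] := f'f.
have [J2 [u2 [v2 [pJ2 hu2 hv2 e2]]]] := ff'.
have [w1 hw1 pw1] := pJ1 _ _ _ _ _ c1 _ hv1.
have [w2 hw2 pw2] := pJ2 _ _ _ _ _ c2 _ hv2.
(* Under p2 the map 1 - m l becomes (1 - f f') p2, an error that factors through J2. Adding the lift
   w2 of that error moves the map into the kernel of p2. *)
have [ka2 hka2 eka2] : exists2 ka : hom k B2 X2, mf_mor ka &
    i2 ** ka = idm k B2 - m ** l + w2 ** u2 ** p2.
  apply: (conflation_kernel c2); first by mf_struct.
  rewrite !hcompE pm -(hcompA f) pl pw2 -e2 !hcompE; mx_abel.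
have [ka1 hka1 eka1] : exists2 ka : hom k B1 X1, mf_mor ka &
    i1 ** ka = idm k B1 - l ** m + w1 ** u1 ** p1.
  apply: (conflation_kernel c1); first by mf_struct.
  rewrite !hcompE pl -(hcompA f') pm pw1 -e1 !hcompE; mx_abel.
have [mu hmu emu] : exists2 mu : hom k X1 X2, mf_mor mu & i2 ** mu = m ** i1.
  apply: (conflation_kernel c2); first by mf_struct.
  by rewrite hcompA pm -hcompA pi1 hcomp0r.
have [la hla ela] : exists2 la : hom k X2 X1, mf_mor la & i1 ** la = l ** i2.
  apply: (conflation_kernel c1); first by mf_struct.
  by rewrite hcompA pl -hcompA pi2 hcomp0r.
have d1 : ka1 ** i1 = idm k X1 - la ** mu.
  have /(congr1 (fun x => r1 ** x)) :
      i1 ** (ka1 ** i1) = i1 ** (idm k X1 - la ** mu : hom k X1 X1).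
    rewrite !hcompE eka1 ela !hcompE (under_hcomp pi1) (under_hcomp emu) !hcompE; mx_abel.
  by rewrite !hcompA ri1 !hcomp1l.
have d2 : ka2 ** i2 = idm k X2 - mu ** la.
  have /(congr1 (fun x => r2 ** x)) :
      i2 ** (ka2 ** i2) = i2 ** (idm k X2 - mu ** la : hom k X2 X2).
    rewrite !hcompE eka2 emu !hcompE (under_hcomp pi2) (under_hcomp ela) !hcompE; mx_abel.
  by rewrite !hcompA ri2 !hcomp1l.
pose F : hom k (mf_sum X1 B2) (mf_sum B1 X2) :=
  injl k B1 X2 ** i1 ** prl k X1 B2 + injl k B1 X2 ** l ** prr k X1 B2
  - injr k B1 X2 ** mu ** prl k X1 B2 + injr k B1 X2 ** ka2 ** prr k X1 B2.
pose G : hom k (mf_sum B1 X2) (mf_sum X1 B2) :=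
  injl k X1 B2 ** ka1 ** prl k B1 X2 - injl k X1 B2 ** la ** prr k B1 X2
  + injr k X1 B2 ** m ** prl k B1 X2 + injr k X1 B2 ** i2 ** prr k B1 X2.
have hF : mf_mor F by rewrite /F; mf_struct.
have hG : mf_mor G by rewrite /G; mf_struct.
pose x : hom k B2 X1 := ka1 ** l - la ** ka2.
pose y : hom k B1 X2 := ka2 ** m - mu ** ka1.
have hx : mf_mor x by rewrite /x; mf_struct.
have hy : mf_mor y by rewrite /y; mf_struct.
(* The off-diagonal parts square to zero, so [cx] and [cy] are the inverses of the unipotent factors
   of G F and F G. *)
pose cx : hom k (mf_sum X1 B2) (mf_sum X1 B2) :=
  idm k (mf_sum X1 B2) - injl k X1 B2 ** x ** prr k X1 B2.
pose cy : hom k (mf_sum B1 X2) (mf_sum B1 X2) :=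
  idm k (mf_sum B1 X2) - injr k B1 X2 ** y ** prl k B1 X2.
have hcx : mf_mor cx by rewrite /cx; mf_struct.
have hcy : mf_mor cy by rewrite /cy; mf_struct.
exists F; apply: (@stable_iso_of_sides _ _ _ (cx ** G) (G ** cy)) => //.
- by mf_struct.
- by mf_struct.
- have GF : G ** F = idm k (mf_sum X1 B2) + injl k X1 B2 ** x ** prr k X1 B2
      + injr k X1 B2 ** w2 ** u2 ** p2 ** prr k X1 B2.
    rewrite -[idm k (mf_sum X1 B2)](inj_pr_id k X1 B2) /G /F /x !(hcompE, biprodE).
    rewrite (under_hcomp d1) (under_hcomp emu) (under_hcomp eka2) !hcompE; mx_abel.
  rewrite -hcompA GF; exists J2, (u2 ** p2 ** prr k X1 B2), (cx ** (injr k X1 B2 ** w2)).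
  split=> //; [by mf_struct|by mf_struct|].
  by rewrite /cx !(hcompE, biprodE); mx_abel.
- have FG : F ** G = idm k (mf_sum B1 X2) + injr k B1 X2 ** y ** prl k B1 X2
      + injl k B1 X2 ** w1 ** u1 ** p1 ** prl k B1 X2.
    rewrite -[idm k (mf_sum B1 X2)](inj_pr_id k B1 X2) /G /F /y !(hcompE, biprodE).
    rewrite (under_hcomp d2) (under_hcomp ela) (under_hcomp eka1) !hcompE; mx_abel.
  rewrite hcompA FG; exists J1, (u1 ** p1 ** prl k B1 X2 ** cy), (injl k B1 X2 ** w1).
  split=> //; [by mf_struct|by mf_struct|].
  by rewrite /cy !(hcompE, biprodE); mx_abel.
Qed.

(** A standard triangle asks for the pushout of the hull X -> I along i. That pushout is W + I,
    because X -> I extends along i to some j on B; W + I is stably W. *)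
Lemma conflation_distinguished X B W Y (V : MF) (i : hom k X B) (p : hom k B W) (S : suspension X) :
  conflation i p -> Y ~= B -> V ~= W ->
  exists (u : hom k X Y) (v : hom k Y V) (w : hom k V (susp_obj S)), distinguished u v w.
Proof.
move=> cip [b ib] [c ic]; have [hi hp [r [s [ri ps pi irsp]]]] := cip.
have [hb [b' [hb' b'b bb']]] := ib.
have [hin hout [ri' [so [ri1 so1 oi irso]]]] := susp_conflation S.
have inI := susp_injective (s := S).
set I := susp_hull S in hin hout ri' so ri1 so1 oi irso inI *.
set inn := susp_in S in hin ri1 oi irso *.
set out := susp_out S in hout so1 oi irso *.
have [j hj ji] := inI _ _ _ _ _ cip _ hin.
have e : s ** p = idm k B - i ** r by rewrite -irsp; mx_abel.
have e' : so ** out = idm k I - inn ** ri' by rewrite -irso; mx_abel.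
(* The map out j vanishes on the image of i, so it descends along p; on W it is computed with the
   section s. *)
have [w1 w1E] : exists w1 : hom k W (susp_obj S), w1 = out ** j ** s by exists (out ** j ** s).
have w1p : w1 ** p = out ** j.
  by rewrite w1E (under_hcomp e) !hcompE (under_hcomp ji) oi hcomp0l oppr0 addr0.
have hw1 : mf_mor w1.
  have : w1 ** mf_d W ** p = mf_d (susp_obj S) ** w1 ** p.
    rewrite -hcompA -(mfE hp) hcompA w1p -hcompA (mfE hj) hcompA (mfE hout).
    by rewrite -!hcompA w1p.
  by move=> /(congr1 (fun x => x ** s)); rewrite !(under_hcomp ps) !hcomp1.
pose v0 : hom k B (mf_sum W I) := injl k W I ** p + injr k W I ** j.
pose w0 : hom k (mf_sum W I) (susp_obj S) := out ** prr k W I - w1 ** prl k W I.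
have hv0 : mf_mor v0 by rewrite /v0; mf_struct.
have hw0 : mf_mor w0 by rewrite /w0; mf_struct.
have std : standard_triangle i v0 w0.
  split=> //; last first.
    exists (injr k W I); split; first exact: mf_mor_injr.
      by rewrite /v0 hcompDl (under_hcomp pi) (under_hcomp ji) hcomp0r add0r.
    by rewrite /w0 !(hcompE, biprodE); mx_abel.
  split=> //; exists (s ** prl k W I + i ** ri' ** (prr k W I - j ** s ** prl k W I : hom k _ _)),
    (injr k W I ** so).
  split.
  - rewrite /v0 !(hcompE, biprodE) (under_hcomp e) !hcompE e (under_hcomp ji).
    by rewrite (under_hcomp ri1) !hcompE; mx_abel.
  - by rewrite /w0 !(hcompE, biprodE) so1; mx_abel.
  - by rewrite /w0 /v0 !(hcompE, biprodE) w1p; mx_abel.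
  - rewrite -[RHS](inj_pr_id k W I) /w0 /v0 w1E !(hcompE, biprodE).
    rewrite (under_hcomp ps) !(under_hcomp pi) !(under_hcomp ji) !(under_hcomp e') !hcompE.
    by mx_abel.
have ic' : stable_iso (injl k W I ** c).
  by apply: stable_iso_comp => //; apply: stable_iso_injl; exact: injective_projective.
have [hc' [c' [hc'' c'c cc']]] := ic'.
exists (b' ** i), (c' ** v0 ** b), (w0 ** (injl k W I ** c)).
split; [by mf_struct|by mf_struct|exact: mf_mor_comp|].
exists X, B, (mf_sum W I), S, i, v0, w0, (idm k X), b, (injl k W I ** c), (idm k _).
split=> //; split=> //.
- exact: stable_iso1.
- split; first exact: mf_mor1.
  by exists (idm k I); split; [exact: mf_mor1|rewrite hcomp1 hcomp1l|rewrite hcomp1 hcomp1l].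
- have := stable_eq_comp_r hi bb'; by rewrite !hcompE.
- have := stable_eq_comp_r hb (stable_eq_comp_r hv0 cc'); by rewrite !hcompE.
- by rewrite hcomp1l; exact: stable_eq_refl.
Qed.

(** * The index *)

Section Index.
Variable T : set (set Z).
Local Notation Tobj := (set_type (@addT R Z k T)).

Lemma K0class_ofD (A B C : Tobj) :
  stably_isomorphic (sval C) (mf_sum (sval A) (sval B)) ->
  K0class_of C = K0class_of A + K0class_of B.
Proof.
move=> h.
have /eqP e : (<< C >> == << A >> + << B >> %[mod Quotient.quot (@split_subgroup R Z k T)]%qT).
  rewrite -Quotient.idealrBE opprD addrA; apply/asboolP => N N0 NB; apply.
  by exists A, B, C.
by rewrite /K0class_of e Quotient.pi_add.
Qed.

Lemma K0classE (A : Tobj) : K0class T (sval A) = K0class_of A.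
Proof.
rewrite /K0class; case: pselect => [h|]; last by case; exact: set_mem (valP A).
by congr K0class_of; apply/val_inj.
Qed.

Lemma TobjP X : addT T X -> exists A : Tobj, sval A = X.
Proof. by move=> h; exists (exist (fun Y => Y \in addT T) X (mem_set h)). Qed.

Lemma K0class_siso_sum X Y W : addT T X -> addT T Y -> addT T W ->
  W ~= mf_sum X Y -> K0class T W = K0class T X + K0class T Y.
Proof.
move=> /TobjP[A <-] /TobjP[B <-] /TobjP[C <-] h.
by rewrite !K0classE; exact: K0class_ofD.
Qed.

Lemma K0class_sum X Y : addT T X -> addT T Y ->
  K0class T (mf_sum X Y) = K0class T X + K0class T Y.
Proof.
by move=> hX hY; apply: K0class_siso_sum => //; [exact: addT_sum|exact: siso_refl].
Qed.

Lemma K0class0 : K0class T (mf_zero Z k) = 0.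
Proof.
have h0 : addT T (mf_zero Z k) by exact: addT0.
have h := K0class_siso_sum h0 h0 h0 (siso_sym (siso_sum0 _)).
by apply: (@addrI _ (K0class T (mf_zero Z k))); rewrite addr0 -h.
Qed.

Hypothesis hT : forall a b c d, T [set a; b] -> T [set c; d] ->
  ext0 (diag_obj k a b) (diag_obj k c d).

Lemma ind_conflation X B W Y (V : MF) (i : hom k X B) (p : hom k B W) :
  conflation i p -> addT T X -> addT T Y -> Y ~= B -> V ~= W ->
  ind T V = K0class T Y - K0class T X.
Proof.
move=> cip /TobjP[A eA] /TobjP[D eD] iY iV; subst X Y.
have [S _] := suspension_exists (sval A).
have [u [v [w dist]]] := conflation_distinguished S cip iY iV.
rewrite !K0classE; apply: xget_unique; first by exists D, A, S, u, v, w.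
move=> _ [D' [A' [S' [u' [v' [w' [dist' ->]]]]]]].
have [X1 [B1 [W1 [i1 [p1 [c1 iX1 iB1 iW1]]]]]] := distinguished_conflation dist'.
have h1 : ext0 B1 (sval A).
  apply: (ext0_siso_l (siso_sym iB1)); apply: (ext0_addT hT).
    by exact: set_mem (valP D').
  by exact: set_mem (valP A).
have h2 : ext0 B X1.
  apply: (ext0_siso_l (siso_sym iY)); apply: (ext0_siso_r (siso_sym iX1)).
  by apply: (ext0_addT hT); [exact: set_mem (valP D) | exact: set_mem (valP A')].
have WW : W ~= W1 := siso_trans (siso_sym iV) iW1.
have iso := stable_schanuel cip c1 WW h1 h2.
have [C eC] : exists C : Tobj, sval C = mf_sum (sval A) (sval D').
  by apply: TobjP; apply: addT_sum; [exact: set_mem (valP A)|exact: set_mem (valP D')].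
have e1 : K0class_of C = K0class_of A + K0class_of D'.
  by apply: K0class_ofD; rewrite eC; exact: siso_refl.
have e2 : K0class_of C = K0class_of D + K0class_of A'.
  apply: K0class_ofD; rewrite eC.
  apply: (siso_trans (siso_sum (siso_refl _) iB1)); apply: (siso_trans iso).
  exact: siso_sum (siso_sym iY) (siso_sym iX1).
by apply/eqP; rewrite subr_eq addrAC eq_sym subr_eq -e2 e1 addrC.
Qed.

End Index.

(** The composite deflation B + D -> V + D -> W has as kernel an extension of A by X. Since Ext^1(A,
    X) = 0, the component A -> V of j lifts through q, and this lift splits the kernel. *)
Lemma conflation_compose X B (V : MF) A (D : MF) W (i : hom k X B) (q : hom k B V)
    (j : hom k A (mf_sum V D)) (p : hom k (mf_sum V D) W) :
  conflation i q -> conflation j p -> ext0 A X ->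
  exists (i' : hom k (mf_sum X A) (mf_sum B D)) (p' : hom k (mf_sum B D) W), conflation i' p'.
Proof.
move=> ciq cjp hAX; have [hi hq [r [s [ri qs qi irsq]]]] := ciq.
have [hj hp [r' [s' [rj ps pj jrsp]]]] := cjp.
have [l hl ql] : exists2 l : hom k A B, mf_mor l & q ** l = prl k V D ** j.
  by apply: (ext0_lift hAX ciq); mf_struct.
have [F FE] : exists F : hom k (mf_sum B D) (mf_sum V D),
    F = injl k V D ** q ** prl k B D + injr k V D ** prr k B D by eexists.
have [G GE] : exists G : hom k (mf_sum V D) (mf_sum B D),
    G = injl k B D ** s ** prl k V D + injr k B D ** prr k V D by eexists.
have hF : mf_mor F by rewrite FE; mf_struct.
have jE : injr k V D ** prr k V D ** j = j - injl k V D ** prl k V D ** j.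
  by rewrite -[X in X - _]hcomp1l -inj_pr_id hcompDl; mx_abel.
have sq : s ** q = idm k B - i ** r by rewrite -irsq; mx_abel.
have FG : F ** G = idm k (mf_sum V D).
  rewrite -[RHS](inj_pr_id k V D) FE GE !(hcompE, biprodE) (under_hcomp qs) !hcompE.
  by mx_abel.
have GF : G ** F = injl k B D ** prl k B D - injl k B D ** i ** r ** prl k B D
    + injr k B D ** prr k B D.
  by rewrite FE GE !(hcompE, biprodE) (under_hcomp sq) !hcompE; mx_abel.
have Gj : G ** j = injl k B D ** l - injl k B D ** i ** r ** l + injr k B D ** prr k V D ** j.
  by rewrite GE !hcompE (under_hcomp (esym ql)) !hcompA (under_hcomp sq) !hcompE.
have [i' i'E] : exists i' : hom k (mf_sum X A) (mf_sum B D), i' =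
    injl k B D ** i ** prl k X A + injl k B D ** l ** prr k X A +
    injr k B D ** prr k V D ** j ** prr k X A by eexists.
have Fi : F ** i' = j ** prr k X A.
  rewrite i'E FE !(hcompE, biprodE) (under_hcomp qi) (under_hcomp ql) jE !hcompE.
  by mx_abel.
exists i', (p ** F); split; [by rewrite i'E; mf_struct | by mf_struct |].
exists (injl k X A ** r ** (prl k B D - l ** r' ** F : hom k _ _) + injr k X A ** r' ** F),
  (G ** s').
split.
- rewrite -[RHS](inj_pr_id k X A) !hcompE !(under_hcomp Fi) i'E !(hcompE, biprodE).
  by rewrite (under_hcomp ri) !(under_hcomp rj) !hcompE; mx_abel.
- by rewrite hcompA (under_hcomp FG) hcomp1.
- by rewrite -hcompA Fi hcompA pj hcomp0l.
- rewrite -[RHS](inj_pr_id k B D) i'E !(hcompE, biprodE).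
  have e : s' ** p = idm k (mf_sum V D) - j ** r' by rewrite -jrsp; mx_abel.
  by rewrite (under_hcomp e) !hcompE GF Gj !hcompE; mx_abel.
Qed.

(** * Ext^1 and exchange conflations for two-term factorisations *)

Lemma ord2P (Q : 'I_2 -> Prop) : Q 0 -> Q 1 -> forall i, Q i.
Proof.
move=> q0 q1 [[|[|//]] h]; first by rewrite (_ : Ordinal h = 0) //; apply/val_inj.
by rewrite (_ : Ordinal h = 1) //; apply/val_inj.
Qed.

Definition mx2 (a b c d : Z) (x y z w : fps k) : hom k (pair_base a b) (pair_base c d) :=
  \matrix_(i < 2, j < 2) if i == 0 then (if j == 0 then x else y) else (if j == 0 then z else w).

Section Mx2.
Variables a b c d : Z.
Implicit Types x y z w : fps k.

Lemma mx2_eta (u : hom k (pair_base a b) (pair_base c d)) :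
  u = mx2 a b c d (u (0 : 'I_2) (0 : 'I_2)) (u (0 : 'I_2) (1 : 'I_2))
          (u (1 : 'I_2) (0 : 'I_2)) (u (1 : 'I_2) (1 : 'I_2)).
Proof. by apply/matrixP; apply: ord2P; apply: ord2P; rewrite mxE. Qed.

Lemma mx2D x y z w x' y' z' w' :
  mx2 a b c d x y z w + mx2 a b c d x' y' z' w' = mx2 a b c d (x + x') (y + y') (z + z') (w + w').
Proof. by apply/matrixP; apply: ord2P; apply: ord2P; rewrite !mxE. Qed.

Lemma mx2N x y z w : - mx2 a b c d x y z w = mx2 a b c d (- x) (- y) (- z) (- w).
Proof. by apply/matrixP; apply: ord2P; apply: ord2P; rewrite !mxE. Qed.

Lemma mx2_0 : mx2 a b c d 0 0 0 0 = 0.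
Proof. by apply/matrixP; apply: ord2P; apply: ord2P; rewrite !mxE. Qed.

Lemma mx2_inj x y z w x' y' z' w' : mx2 a b c d x y z w = mx2 a b c d x' y' z' w' ->
  [/\ x = x', y = y', z = z' & w = w'].
Proof.
by move=> /matrixP e; move: (e 0 0) (e 0 1) (e 1 0) (e 1 1); rewrite !mxE.
Qed.

Lemma mx2_comp e f x y z w x' y' z' w' :
  mx2 c d e f x' y' z' w' ** mx2 a b c d x y z w = mx2 a b e f
    (t ^+ wind a c e * x' * x + t ^+ wind a d e * y' * z)
    (t ^+ wind b c e * x' * y + t ^+ wind b d e * y' * w)
    (t ^+ wind a c f * z' * x + t ^+ wind a d f * w' * z)
    (t ^+ wind b c f * z' * y + t ^+ wind b d f * w' * w).
Proof.
apply/matrixP; apply: ord2P; apply: ord2P;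
  by rewrite mxE /= !big_ord_recl big_ord0 addr0 !mxE.
Qed.

End Mx2.

Lemma wind01 (a b c : Z) : wind a b c = 0%N \/ wind a b c = 1%N.
Proof. by have := wind_le1 a b c; case: (wind a b c) => [|[|]]; auto. Qed.

(** If one of the four exponents in the conclusion is 0, its unknown is solved for directly, and the
    other equation follows by cancelling a power of t. If all four are 1, then x = - w and a <= c <
    b <= d < a; as there is no crossing, a = c or b = d, and the radical condition makes x divisible
    by t. *)
Lemma noncrossing_split (a b c d : Z) (x w : fps k) : a <> b -> c <> d -> ~ cross4 a c b d ->
  (a = c -> dvdt x) -> (b = d -> dvdt w) ->
  t ^+ wind a c d * x + t ^+ wind a b d * w = 0 ->
  t ^+ wind b d c * w + t ^+ wind b a c * x = 0 ->
  exists h h', x = t ^+ wind a b c * h - t ^+ wind a d c * h' /\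
               w = t ^+ wind b a d * h' - t ^+ wind b c d * h.
Proof.
move=> ab cd ncr hx hw E1 E2.
have C1 := wind_cocycle a b c d; have C2 := wind_cocycle b a d c.
have F1 : t ^+ wind a c d * x = - (t ^+ wind a b d * w) by apply/eqP; rewrite -addr_eq0 E1.
have F2 : t ^+ wind b d c * w = - (t ^+ wind b a c * x) by apply/eqP; rewrite -addr_eq0 E2.
have [e|e1] := wind01 a b c.
  exists x, 0; split; first by rewrite e; ring.
  rewrite mulr0 sub0r; apply: (@fps_tX_cancel _ (wind a b d)).
  by rewrite mulrN mulrA -exprD -C1 e add0n F1 opprK.
have [e|e2] := wind01 b c d.
  exists (- w), 0; split; last by rewrite e; ring.
  rewrite mulr0 subr0 mulrN; apply: (@fps_tX_cancel _ (wind a c d)).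
  by rewrite mulrN mulrA -exprD addnC C1 e addn0 F1.
have [e|e3] := wind01 a d c.
  exists 0, (- x); split; first by rewrite e; ring.
  rewrite mulr0 subr0 mulrN; apply: (@fps_tX_cancel _ (wind b d c)).
  by rewrite mulrN mulrA -exprD addnC C2 e addn0 F2.
have [e|e4] := wind01 b a d.
  exists 0, w; split; last by rewrite e; ring.
  rewrite mulr0 sub0r; apply: (@fps_tX_cancel _ (wind b a c)).
  by rewrite mulrN mulrA -exprD -C2 e add0n F2 opprK.
have xw : x = - w.
  by apply: (@fps_tX_cancel _ (wind a c d)); rewrite F1 mulrN; congr (- (t ^+ _ * _)); lia.
have [g gx] : dvdt x.
  have [ac|nac] := pselect (a = c); first exact: hx.
  have [bd|nbd] := pselect (b = d); first by rewrite xw; apply: dvdtN; exact: hw.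
  case: ncr; split; split.
  - by move: e1; rewrite /wind; case: asboolP => // -[].
  - by move=> /val_inj ca; apply: nac.
  - by move: e1; rewrite /wind; case: asboolP => // -[_ h] _ /val_inj.
  - by move: e4; rewrite /wind; case: asboolP => // -[].
  - by move=> /val_inj db; apply: nbd.
  - by move: e4; rewrite /wind; case: asboolP => // -[_ h] _ /val_inj.
exists g, 0; rewrite e1 e2 !mulr0 expr1 subr0 sub0r -gx; split=> //.
by rewrite xw opprK.
Qed.

Section Pairs.
Variables (a b : Z) (ab : a <> b).

Lemma pair_dE : mf_d (mf_pair k ab) = mx2 a b a b 0 1 1 0.
Proof. by apply/matrixP; apply: ord2P; apply: ord2P; rewrite !mxE. Qed.

Lemma pair_idE : idm k (mf_pair k ab) = mx2 a b a b 1 0 0 1.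
Proof. by apply/matrixP; apply: ord2P; apply: ord2P; rewrite !mxE. Qed.

End Pairs.

Lemma ext0_pair (a b c d : Z) (ab : a <> b) (cd : c <> d) : ~ crossing a b c d ->
  ext0 (mf_pair k ab) (mf_pair k cd).
Proof.
move=> ncr u [ru]; rewrite !pair_dE.
have ca : a = c -> dvdt (u (0 : 'I_2) (0 : 'I_2)) by move=> e; exact: (ru (0 : 'I_2) (0 : 'I_2)).
have da : a = d -> dvdt (u (1 : 'I_2) (0 : 'I_2)) by move=> e; exact: (ru (1 : 'I_2) (0 : 'I_2)).
have cb : b = c -> dvdt (u (0 : 'I_2) (1 : 'I_2)) by move=> e; exact: (ru (0 : 'I_2) (1 : 'I_2)).
have db : b = d -> dvdt (u (1 : 'I_2) (1 : 'I_2)) by move=> e; exact: (ru (1 : 'I_2) (1 : 'I_2)).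
move: ca da cb db; rewrite /cobound [u]mx2_eta !pair_dE.
move: (u _ _) (u _ _) (u _ _) (u _ _) => x y z w.
rewrite ![mx2 _ _ _ _ _ _ _ _ (0 : 'I_2) _]mxE ![mx2 _ _ _ _ _ _ _ _ (1 : 'I_2) _]mxE /=.
move=> ca da cb db.
have e0 : (0 : hom k (pair_base a b) (pair_base c d)) = mx2 a b c d 0 0 0 0 by rewrite mx2_0.
rewrite !mx2_comp mx2D [X in _ = X]e0 => /mx2_inj[].
rewrite !(mulr0, mul0r, addr0, add0r, mulr1) => E1 E2 E3 E4.
have n1 : ~ cross4 a c b d by move=> h; apply: ncr; left.
have n2 : ~ cross4 a d b c by move=> h; apply: ncr; right.
(* The entries x, w and the entries y, z satisfy separate systems; the second is the first with c
   and d exchanged. These are the two kinds of crossing. *)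
have [h1 [h2 [ex ew]]] := noncrossing_split ab cd n1 ca db E3 E2.
have [h3 [h0 [ez ey]]] := noncrossing_split ab (nesym cd) n2 da cb E1 E4.
exists (mx2 a b c d h0 h1 h2 h3); rewrite !mx2_comp mx2N mx2D.
rewrite !(mulr0, mul0r, addr0, add0r, mulr1).
by rewrite -ex -ey -ez -ew.
Qed.

Lemma pair_edge_null (a b : Z) (ab : a <> b) : is_edge a b -> null (idm k (mf_pair k ab)).
Proof.
move=> [_ e].
(* For an edge, the component of the differential from z^+ to z lies in [Corad] and by itself is a
   homotopy for t. *)
pose G : hom k (mf_pair k ab) (mf_pair k ab) :=
  if pselect (b = succZ a) then mx2 a b a b 0 1 0 0 else mx2 a b a b 0 0 1 0.
exists G; split.
  rewrite /G; case: pselect => [ea|nea].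
    apply: ord2P; apply: ord2P; rewrite /= mxE /= => h; try exact: dvdt0.
    by case: (h ea).
  case: e => // e.
  apply: ord2P; apply: ord2P; rewrite /= mxE /= => h; try exact: dvdt0.
  by case: (h e).
rewrite pair_idE pair_dE /G.
have eZ : t *: mx2 a b a b 1 0 0 1 = mx2 a b a b t 0 0 t.
  by apply/matrixP; apply: ord2P; apply: ord2P; rewrite !mxE /= ?mulr0 ?mulr1.
rewrite eZ; case: pselect => ea; rewrite !mx2_comp mx2D;
  rewrite !(mulr0, mul0r, addr0, add0r, mulr1) !wind_xyx ?expr1 //; by move=> /esym.
Qed.

Lemma diag_obj_pair (a b : Z) (ab : a <> b) : diag_obj k a b ~= mf_pair k ab.
Proof.
rewrite /diag_obj; case: pselect => [h|nd].
  by rewrite (Prop_irrelevance (proj1 h) ab); exact: siso_refl.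
apply: siso_sym; apply: null_siso0; apply: pair_edge_null.
by apply: contrapT => ne; apply: nd.
Qed.

Lemma ext0_diag (a b c d : Z) : ~ crossing a b c d -> ext0 (diag_obj k a b) (diag_obj k c d).
Proof.
move=> ncr; rewrite /diag_obj; case: pselect => [h|_]; last by apply: null_ext0_l; exact: null_zero.
case: pselect => [h'|_]; last by apply: null_ext0_r; exact: null_zero.
exact: ext0_pair.
Qed.

Lemma wind_rot (a b c : Z) : a <> b -> a <> c -> wind b c a = wind a b c.
Proof. by move=> ab ac; have := wind_cocycle a b c a; rewrite !wind_xyx //; lia. Qed.

Lemma wind_rev (a b c : Z) : a <> b -> wind a b c = 0%N -> wind b a c = 1%N.
Proof.
by move=> ab e; have := wind_cocycle a b a c; rewrite wind_xyx // wind_xx e; lia.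
Qed.

(* The vertices occur in the cyclic order a < b < d < c. *)
Lemma exchange_conflation (a b c d : Z)
    (bc : b <> c) (ab : a <> b) (cd : c <> d) (ad : a <> d) : a <> c -> b <> d ->
  [/\ wind a b d = 0, wind b d c = 0, wind d c a = 0 & wind c a b = 0]%N ->
  exists (i : hom k (mf_pair k bc) (mf_sum (mf_pair k ab) (mf_pair k cd)))
    (p : hom k (mf_sum (mf_pair k ab) (mf_pair k cd)) (mf_pair k ad)), conflation i p.
Proof.
move=> ac bd [w1 w2 w3 w4].
(* The twelve positively oriented triples of distinct vertices have exponent 0 and the twelve
   reversed ones exponent 1; this settles every product below. *)
have w1' : wind b d a = 0%N by rewrite wind_rot.
have w1'' : wind d a b = 0%N by rewrite wind_rot //; exact: nesym.
have w2' : wind d c b = 0%N by rewrite wind_rot.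
have w2'' : wind c b d = 0%N by rewrite wind_rot //; exact: nesym.
have w3' : wind c a d = 0%N by rewrite wind_rot //; exact: nesym.
have w3'' : wind a d c = 0%N by rewrite wind_rot //; exact: nesym.
have w4' : wind a b c = 0%N by rewrite wind_rot //; exact: nesym.
have w4'' : wind b c a = 0%N by rewrite wind_rot.
have [ba cb dc da] := And4 (nesym ab) (nesym bc) (nesym cd) (nesym ad).
have [ca db] := conj (nesym ac) (nesym bd).
have [v1 v1' v1''] := And3 (wind_rev ab w1) (wind_rev bd w1') (wind_rev da w1'').
have [v2 v2' v2''] := And3 (wind_rev bd w2) (wind_rev dc w2') (wind_rev cb w2'').
have [v3 v3' v3''] := And3 (wind_rev dc w3) (wind_rev ca w3') (wind_rev ad w3'').
have [v4 v4' v4''] := And3 (wind_rev ca w4) (wind_rev ab w4') (wind_rev bc w4'').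
have E := (w1, w1', w1'', w2, w2', w2'', w3, w3', w3'', w4, w4', w4'',
  v1, v1', v1'', v2, v2', v2'', v3, v3', v3'', v4, v4', v4'', wind_xyy, wind_xx).
pose f1 : hom k (mf_pair k bc) (mf_pair k ab) := mx2 b c a b 0 1 1 0.
pose f2 : hom k (mf_pair k bc) (mf_pair k cd) := mx2 b c c d 0 1 1 0.
pose g1 : hom k (mf_pair k ab) (mf_pair k ad) := mx2 a b a d 1 0 0 1.
pose g2 : hom k (mf_pair k cd) (mf_pair k ad) := mx2 c d a d 1 0 0 1.
(* Each vertex of {a, d} is lifted to the summand containing it, and b, c are recovered from {a, b}
   and {c, d}. The sign in [r2] matches the inflation (f1, - f2). *)
pose s1 : hom k (mf_pair k ad) (mf_pair k ab) := mx2 a d a b 1 0 0 0.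
pose s2 : hom k (mf_pair k ad) (mf_pair k cd) := mx2 a d c d 0 0 0 1.
pose r1 : hom k (mf_pair k ab) (mf_pair k bc) := mx2 a b b c 0 1 0 0.
pose r2 : hom k (mf_pair k cd) (mf_pair k bc) := mx2 c d b c 0 0 (-1) 0.
have m1 : mf_mor f1.
  by apply: mfP; rewrite !pair_dE /f1 !mx2_comp !E !(mulr0, mul0r, addr0, add0r, mulr1).
have m2 : mf_mor f2.
  by apply: mfP; rewrite !pair_dE /f2 !mx2_comp !E !(mulr0, mul0r, addr0, add0r, mulr1).
have m3 : mf_mor g1.
  by apply: mfP; rewrite !pair_dE /g1 !mx2_comp !E !(mulr0, mul0r, addr0, add0r, mulr1).
have m4 : mf_mor g2.
  by apply: mfP; rewrite !pair_dE /g2 !mx2_comp !E !(mulr0, mul0r, addr0, add0r, mulr1).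
have e1 : r1 ** f1 - r2 ** f2 = idm k (mf_pair k bc).
  rewrite pair_idE /r1 /f1 /r2 /f2 !mx2_comp mx2N mx2D !E.
  by rewrite !(mulr0, mul0r, addr0, add0r, mulr1, expr0, mulrN1, oppr0, opprK).
have e2 : g1 ** s1 + g2 ** s2 = idm k (mf_pair k ad).
  rewrite pair_idE /g1 /s1 /g2 /s2 !mx2_comp mx2D !E.
  by rewrite !(mulr0, mul0r, addr0, add0r, mulr1, expr0).
have e3 : g1 ** f1 = g2 ** f2.
  rewrite /g1 /f1 /g2 /f2 !mx2_comp !E.
  by rewrite !(mulr0, mul0r, addr0, add0r, mulr1, expr0).
have e4 : f1 ** r1 + s1 ** g1 = idm k (mf_pair k ab).
  rewrite pair_idE /g1 /s1 /f1 /r1 !mx2_comp mx2D !E.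
  by rewrite !(mulr0, mul0r, addr0, add0r, mulr1, expr0).
have e5 : s2 ** g2 - f2 ** r2 = idm k (mf_pair k cd).
  rewrite pair_idE /g2 /s2 /f2 /r2 !mx2_comp mx2N mx2D !E.
  by rewrite !(mulr0, mul0r, addr0, add0r, mulr1, expr0, mulrN1, oppr0, opprK).
have e6 : f1 ** r2 = - (s1 ** g2).
  rewrite /g2 /s1 /f1 /r2 !mx2_comp mx2N !E.
  by rewrite !(mulr0, mul0r, addr0, add0r, mulr1, expr0, mulrN1, oppr0, opprK).
have e7 : f2 ** r1 = s2 ** g1.
  rewrite /g1 /s2 /f2 /r1 !mx2_comp !E.
  by rewrite !(mulr0, mul0r, addr0, add0r, mulr1, expr0).
move: f1 f2 g1 g2 s1 s2 r1 r2 m1 m2 m3 m4 e1 e2 e3 e4 e5 e6 e7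
  => f1 f2 g1 g2 s1 s2 r1 r2 m1 m2 m3 m4 e1 e2 e3 e4 e5 e6 e7.
set X := mf_pair k ab in f1 g1 s1 r1 m1 m3 e1 e2 e3 e4 e5 e6 e7 *.
set Y := mf_pair k cd in f2 g2 s2 r2 m2 m4 e1 e2 e3 e4 e5 e6 e7 *.
exists (injl k X Y ** f1 - injr k X Y ** f2), (g1 ** prl k X Y + g2 ** prr k X Y).
split; [by mf_struct | by mf_struct |].
exists (r1 ** prl k X Y + r2 ** prr k X Y), (injl k X Y ** s1 + injr k X Y ** s2); split.
- by rewrite !(hcompE, biprodE) -e1; mx_abel.
- by rewrite !(hcompE, biprodE) -e2; mx_abel.
- by rewrite !(hcompE, biprodE) e3; mx_abel.
- rewrite -[RHS](inj_pr_id k X Y) -[in RHS](hcomp1 (injl k X Y)) -[in RHS](hcomp1 (injr k X Y)).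
  rewrite -e4 -e5 !(hcompE, biprodE) (under_hcomp e6) (under_hcomp e7) !hcompE.
  by mx_abel.
Qed.

(** * The zig-zag path *)

Section Zigzag.
Variable T : set (set Z).
Hypothesis T_diag : forall a b : Z, T [set a; b] -> is_diagonal a b.
Hypothesis T_noncrossing : forall a b c d : Z, T [set a; b] -> T [set c; d] -> ~ crossing a b c d.

Lemma ext0_T X Y : addT T X -> addT T Y -> ext0 X Y.
Proof.
apply: ext0_addT => a b c d hab hcd; apply: ext0_diag; exact: T_noncrossing.
Qed.

Lemma addT_linked (a b : Z) : linked T a b -> addT T (diag_obj k a b).
Proof.
case=> [eab|]; last exact: addT_diag.
by rewrite /diag_obj; case: pselect => [[_ []]//|_]; exact: addT0.
Qed.

(** The pair {e, e_{2n+1}} need not lie in add T, so the induction carries a conflation ending in it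
    rather than a class. Each step trades it for the next pair, of which it is an exchange
    summand. *)
Lemma zigzag_conflation (p : nat -> Z) (n : nat) :
  linked T (p 0%N) (p 1%N) ->
  (forall m, (m <= n)%N -> p 0%N <> p m.*2.+1) ->
  (forall m, (m < n)%N -> [/\ T [set p m.*2.+1; p m.*2.+2],
     linked T (p m.*2.+2) (p m.*2.+3), p 0%N <> p m.*2.+2, p m.*2.+2 <> p m.*2.+3
     & p m.*2.+1 <> p m.*2.+3 /\
       [/\ wind (p 0) (p m.*2.+1) (p m.*2.+3) = 0,
        wind (p m.*2.+1) (p m.*2.+3) (p m.*2.+2) = 0,
        wind (p m.*2.+3) (p m.*2.+2) (p 0) = 0 &
        wind (p m.*2.+2) (p 0) (p m.*2.+1) = 0]%N]) ->
  exists (ne : p 0%N <> p n.*2.+1) (X B Y : MF)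
      (i : hom k X B) (q : hom k B (mf_pair k ne)),
    [/\ conflation i q, addT T X, addT T Y, Y ~= B &
    K0class T Y - K0class T X =
      \sum_(m < n.*2.+1) K0class T (diag_obj k (p m) (p m.+1)) *~ (-1) ^+ m].
Proof.
move=> l01 ne0; elim: n ne0 => [|n IH] ne0 hn.
  have ne := ne0 0%N isT.
  exists ne, (mf_zero Z k), (mf_pair k ne), (diag_obj k (p 0%N) (p 1%N)), 0,
    (idm k (mf_pair k ne)); split.
  - split; [exact: mf_mor0|exact: mf_mor1|].
    exists 0, (idm k (mf_pair k ne)); split.
    + by apply/matrixP => -[].
    + by rewrite hcomp1.
    + by rewrite hcomp1l.
    + by rewrite hcomp0l add0r hcomp1.
  - exact: addT0.
  - exact: addT_linked.
  - exact: diag_obj_pair.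
  - by rewrite K0class0 subr0 big_ord_recl big_ord0 addr0.
have [||ne [X [B [Y [i [q [ciq aX aY iY eK]]]]]]] := IH.
- by move=> m mn; apply: ne0; exact: leqW.
- by move=> m mn; apply: hn; exact: ltnW.
have [Tbc lcd ac cd [bd winds]] := hn n (ltnSn n).
have dbc := T_diag Tbc; have bc := proj1 dbc.
have ad : p 0%N <> p n.*2.+3 := ne0 n.+1 (leqnn _).
have [j [r cjr]] : exists
    (j : hom k (mf_pair k bc) (mf_sum (mf_pair k ne) (mf_pair k cd)))
    (r : hom k (mf_sum (mf_pair k ne) (mf_pair k cd)) (mf_pair k ad)), conflation j r.
  exact: exchange_conflation.
(* An odd term lies in T and so is a true diagonal: its [diag_obj] is equal to the [mf_pair], not
   merely stably isomorphic to it. *)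
have aA : addT T (mf_pair k bc).
  have : addT T (diag_obj k (p n.*2.+1) (p n.*2.+2)) by exact: addT_diag.
  rewrite /diag_obj; case: pselect => [h|nh]; last by case: nh.
  by rewrite (Prop_irrelevance (proj1 h) bc).
have eA : K0class T (mf_pair k bc) = K0class T (diag_obj k (p n.*2.+1) (p n.*2.+2)).
  rewrite /diag_obj; case: pselect => [h|nh]; last by case: nh.
  by rewrite (Prop_irrelevance (proj1 h) bc).
have [i' [q' c']] := conflation_compose ciq cjr (ext0_T aA aX).
exists ad, (mf_sum X (mf_pair k bc)), (mf_sum B (mf_pair k cd)),
  (mf_sum Y (diag_obj k (p n.*2.+2) (p n.*2.+3))), i', q'; split=> //.
- exact: addT_sum.
- by apply: addT_sum => //; exact: addT_linked.
- by apply: siso_sum => //; exact: diag_obj_pair.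
- rewrite !K0class_sum //; last exact: addT_linked.
  rewrite doubleS 2!big_ord_recr /= -eK -eA.
  rewrite -[in (-1) ^+ n.*2.+1]signr_odd -[in (-1) ^+ n.*2.+2]signr_odd /= odd_double /=.
  by rewrite expr1 expr0 mulrN1z mulr1z opprD addrACA [_ - K0class T (mf_pair k bc)]addrC addrA.
Qed.

Lemma ind_zigzag (p : nat -> Z) (n : nat) :
  linked T (p 0%N) (p 1%N) ->
  (forall m, (m <= n)%N -> p 0%N <> p m.*2.+1) ->
  (forall m, (m < n)%N -> [/\ T [set p m.*2.+1; p m.*2.+2],
     linked T (p m.*2.+2) (p m.*2.+3), p 0%N <> p m.*2.+2, p m.*2.+2 <> p m.*2.+3
     & p m.*2.+1 <> p m.*2.+3 /\
       [/\ wind (p 0) (p m.*2.+1) (p m.*2.+3) = 0,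
        wind (p m.*2.+1) (p m.*2.+3) (p m.*2.+2) = 0,
        wind (p m.*2.+3) (p m.*2.+2) (p 0) = 0 &
        wind (p m.*2.+2) (p 0) (p m.*2.+1) = 0]%N]) ->
  ind T (diag_obj k (p 0%N) (p n.*2.+1)) =
    \sum_(m < n.*2.+1) K0class T (diag_obj k (p m) (p m.+1)) *~ (-1) ^+ m.
Proof.
move=> l01 ne0 hn.
have [ne [X [B [Y [i [q [ciq aX aY iY <-]]]]]]] := zigzag_conflation l01 ne0 hn.
apply: (ind_conflation _ ciq) => //; last exact: diag_obj_pair.
by move=> a b c d hab hcd; apply: ext0_diag; exact: T_noncrossing.
Qed.

End Zigzag.

End FrobeniusCategory.

(** Members of T are unordered pairs, so the presentation as [[set a; b]] has to be matched with the
    given diagonal in either order. *)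
Lemma set2_diagonal (R : realType) (Z : set (circle R)) (T : set (set Z)) (a b : Z) :
  noncrossing_diagonals T -> T [set a; b] -> is_diagonal a b.
Proof.
move=> [hd _] /hd[c [d [e [cd ned]]]].
have /= /(_ (or_introl erefl)) ha : [set a; b] a -> [set c; d] a by rewrite e.
have /= /(_ (or_intror erefl)) hb : [set a; b] b -> [set c; d] b by rewrite e.
have /= /(_ (or_introl erefl)) hc : [set c; d] c -> [set a; b] c by rewrite e.
have /= /(_ (or_intror erefl)) hd' : [set c; d] d -> [set a; b] d by rewrite e.
case: ha hb hc hd' => [->|->] [->|->].
- by move=> _ [] dc; case: cd.
- by [].
- move=> _ _; split; first exact: nesym.
  by move=> [_ [h|h]]; apply: ned; split=> //; [right|left].
- by move=> [] dc; case: cd.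
Qed.

Theorem theorem6p3 (R : realType) (k : closedFieldType) (Z : set (circle R))
  (hcard : (`I_4 #<= Z)%card)
  (hdiscrete : forall z, Z z -> ~ is_limit Z z)
  (htwosided : forall y, is_limit Z y -> two_sided_limit Z y)
  (T : set (set Z)) (hT : triangulation T)
  (e f : Z) (hef : e <> f)
  (i : nat) (p : nat -> Z) (hp : zigzag T e f i p) :
  ind T (diag_obj k e f) =
    \sum_(m < i.*2.+1) K0class T (diag_obj k (p m) (p m.+1)) *~ (-1) ^+ m.
Proof.
have succ_spec := succZ_spec hdiscrete htwosided hef.
have pred_spec := predZ_spec hdiscrete htwosided hef.
have [ncT _ _] := hT.
have [p0 pf l01 ne0 steps] := zigzag_order succ_spec pred_spec hef hp.
rewrite -{1}p0 -{1}pf; apply: ind_zigzag => //.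
- by move=> z; case: (succ_spec z).
- by move=> z; exists (predZ z); exact: (predZK hdiscrete htwosided hef).
- by move=> a b; exact: set2_diagonal.
- by case: ncT.
Qed.
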